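(* Let $\bm F:\mathbb{R}^n\to\mathbb{R}^n$ be $\mathcal{C}^2$, let $J(\bm x)=\nabla\bm F(\bm x)$ denote its Jacobian, and let $1\le k\le n$. Consider the $k$-GHiSD system in the unknowns $(\bm x,\bm v_1,\dots,\bm v_k)\in(\mathbb{R}^n)^{k+1}$: $$\dot{\bm x}=\Big(I-2\sum_{j=1}^{k}\bm v_j\bm v_j^\top\Big)\bm F(\bm x),\qquad \dot{\bm v}_i=\big(I-\bm v_i\bm v_i^\top\big)J(\bm x)\bm v_i-\sum_{j=1}^{i-1}\bm v_j\bm v_j^\top\big(J(\bm x)+J(\bm x)^\top\big)\bm v_i,\quad i=1,\dots,k.$$ Let $\bm x^*\in\mathbb{R}^n$ and let $\bm v_1^*,\dots,\bm v_k^*\in\mathbb{R}^n$ satisfy $\langle\bm v_j^*,\bm v_i^*\rangle=\delta_{ij}$ for $i,j=1,\dots,k$. Assume that the eigenvalues of $J^*=J(\bm x^* )$ are all real and nonzero and can be ordered as $\lambda_1>\lambda_2>\cdots>\lambda_k>\lambda_{k+1}\ge\cdots\ge\lambda_n$ (counted with algebraic multiplicity), and let $\bm w_j\in\mathbb{R}^n$ be a right eigenvector of $J^*$ for $\lambda_j$, $j=1,\dots,k$. Then $(\bm x^*,\bm v_1^*,\dots,\bm v_k^* )$ is a linearly stable stationary point of the $k$-GHiSD system (i.e. it is a stationary point and all eigenvalues of the Jacobian of the right-hand side of the system with respect to $(\bm x,\bm v_1,\dots,\bm v_k)$, evaluated at this point, have negative real part) if and only if $\bm x^*$ is an index-$k$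 saddle of $\dot{\bm x}=\bm F(\bm x)$ and, for each $i=1,\dots,k$, $\{\bm v_1^*,\dots,\bm v_i^*\}$ is an orthonormal basis of $\mathrm{span}\{\bm w_1,\dots,\bm w_i\}$.
   Context: $\langle\bm x,\bm y\rangle=\bm y^\top\bm x$ is the standard inner product on $\mathbb{R}^n$. For the dynamical system $\dot{\bm x}=\bm F(\bm x)$, a stationary point is a point $\bm x^*$ with $\bm F(\bm x^* )=\bm 0$. It is hyperbolic if no eigenvalue of $J(\bm x^* )$ has zero real part. The unstable subspace $\mathcal{W}^{\mathrm u}(\bm x^* )$ is the real part of the span of the (generalized) eigenvectors of $J(\bm x^* )$ with eigenvalues of positive real part. A hyperbolic stationary point $\bm x^*$ is an index-$k$ saddle ($k$-saddle) if $\dim\mathcal{W}^{\mathrm u}(\bm x^* )=k$, i.e. $J(\bm x^* )$ has exactly $k$ eigenvalues (with multiplicity) with positive real part and none with zero real part. *)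

(* Defs.v *)
From HB Require Import structures.
From mathcomp Require Import all_boot all_order all_algebra.
Set Implicit Arguments. Unset Strict Implicit. Unset Printing Implicit Defensive.
Import Order.TTheory GRing.Theory Num.Theory.
Local Open Scope ring_scope.

Section Defs.
Variable R : rcfType.

Definition mxnorm {p q : nat} (A : 'M[R]_(p, q)) : R :=
  \big[Num.max/0]_(i < p) \big[Num.max/0]_(j < q) `|A i j|.

Definition is_deriv {m p : nat} (f : 'cV[R]_m -> 'cV[R]_p) (x : 'cV[R]_m)
    (L : 'M[R]_(p, m)) : Prop :=
  forall eps : R, 0 < eps -> exists2 d : R, 0 < d &
    forall h : 'cV[R]_m, mxnorm h < d ->
      mxnorm (f (x + h) - f x - L *m h) <= eps * mxnorm h.

Definition continuous_at {m p q : nat} (H : 'cV[R]_m -> 'M[R]_(p, q))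
    (x : 'cV[R]_m) : Prop :=
  forall eps : R, 0 < eps -> exists2 d : R, 0 < d &
    forall y : 'cV[R]_m, mxnorm (y - x) < d -> mxnorm (H y - H x) < eps.

Definition C2_with_jacobian {n : nat} (F : 'cV[R]_n -> 'cV[R]_n)
    (J : 'cV[R]_n -> 'M[R]_n) : Prop :=
  (forall x, is_deriv F x (J x)) /\
  exists H : 'cV[R]_n -> 'M[R]_(n * n, n),
    (forall x, is_deriv (fun y => (mxvec (J y))^T) x (H x)) /\
    (forall x, continuous_at H x).

(* Real 2m x 2m representation of the complex matrix A - (a + i b) I acting on
   z = u + i w, written as col_mx u w. *)
Definition cplx_shift {m : nat} (A : 'M[R]_m) (a b : R) : 'M[R]_(m + m) :=
  block_mx (A - a%:M) (b%:M) (- b%:M) (A - a%:M).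

Definition cplx_eigenvalue {m : nat} (A : 'M[R]_m) (a b : R) : Prop :=
  exists2 z : 'cV[R]_(m + m), z != 0 & cplx_shift A a b *m z = 0.

Definition all_eig_neg_re {m : nat} (A : 'M[R]_m) : Prop :=
  forall a b : R, cplx_eigenvalue A a b -> a < 0.

Definition hyperbolic_mx {m : nat} (A : 'M[R]_m) : Prop :=
  forall a b : R, cplx_eigenvalue A a b -> a != 0.

(* unstable subspace: real parts of (sums of) complex generalized eigenvectors
   of A for eigenvalues with positive real part *)
Definition unstable_subspace {m : nat} (A : 'M[R]_m) (u : 'cV[R]_m) : Prop :=
  exists (N : nat) (a b : 'I_N -> R) (z : 'I_N -> 'cV[R]_(m + m)),
    [/\ forall l, 0 < a l,
        forall l, (cplx_shift A (a l) (b l)) ^+ m *m z l = 0 &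
        u = \sum_(l < N) usubmx (z l)].

Definition has_dim {m : nat} (W : 'cV[R]_m -> Prop) (d : nat) : Prop :=
  exists B : 'M[R]_(d, m), row_free B /\
    forall u : 'cV[R]_m, W u <-> exists c : 'rV[R]_d, u = (c *m B)^T.

Definition index_saddle {n : nat} (F : 'cV[R]_n -> 'cV[R]_n)
    (J : 'cV[R]_n -> 'M[R]_n) (x : 'cV[R]_n) (k : nat) : Prop :=
  [/\ F x = 0, hyperbolic_mx (J x) & has_dim (unstable_subspace (J x)) k].

(* The k-GHiSD vector field on the state s = col_mx x (mxvec V)^T, where the
   rows of V : 'M_(k, n) are v_1^T, ..., v_k^T. *)
Definition ghisd_v {n k : nat} (s : 'cV[R]_(n + k * n)) (i : 'I_k) : 'cV[R]_n :=
  (row i (vec_mx (dsubmx s)^T))^T.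

Definition ghisd_state {n k : nat} (x : 'cV[R]_n) (v : 'I_k -> 'cV[R]_n)
    : 'cV[R]_(n + k * n) :=
  col_mx x (mxvec (\matrix_(i < k) (v i)^T))^T.

Definition ghisd_field {n k : nat} (F : 'cV[R]_n -> 'cV[R]_n)
    (J : 'cV[R]_n -> 'M[R]_n) (s : 'cV[R]_(n + k * n)) : 'cV[R]_(n + k * n) :=
  let x := usubmx s in
  let v := ghisd_v s in
  col_mx ((1%:M - 2%:R *: \sum_(j < k) v j *m (v j)^T) *m F x)
    (mxvec (\matrix_(i < k)
       ((1%:M - v i *m (v i)^T) *m J x *m v i
        - \sum_(j < k | (j < i)%N) v j *m (v j)^T *m (J x + (J x)^T) *m v i)^T))^T.

Definition lin_stable_stationary {N : nat} (G : 'cV[R]_N -> 'cV[R]_N)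
    (s : 'cV[R]_N) : Prop :=
  G s = 0 /\ exists2 DG : 'M[R]_N, is_deriv G s DG & all_eig_neg_re DG.

Definition rows_upto {n k : nat} (f : 'I_k -> 'cV[R]_n) (i : 'I_k) : 'M[R]_(k, n) :=
  \matrix_(j < k) (if (j <= i)%N then (f j)^T else 0).

End Defs.

(* Main.v *)
Require Import Defs.
From HB Require Import structures.
From mathcomp Require Import all_boot all_order all_algebra.
From mathcomp Require Import ring lra zify.
Import Order.TTheory GRing.Theory Num.Theory.
Local Open Scope ring_scope.
Set Implicit Arguments. Unset Strict Implicit. Unset Printing Implicit Defensive.

(** Let [P_i] be the orthogonal projection on [span(v_1, ..., v_i)]. Stationarity
    means [F(x) = 0] and that the spans of [v_1, ..., v_i] form a flag of
    [J]-invariant subspaces; let [mu_i = <J v_i, v_i>] be the eigenvalue of [J] on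
    the [i]-th graded piece. At such a point the Jacobian of the system is block
    lower triangular, with diagonal blocks [(I - 2 P_k) J] and
    [B_i = J - P_i (J + J^T) - mu_i I]. In a basis adapted to the decomposition
    into the range of [P_i] and its orthogonal complement, [(I - 2 P_k) J] has
    eigenvalues [- mu_j] for [j <= k] and those of [J] on the quotient by the
    range of [P_k], while [B_i] has eigenvalues [- mu_j - mu_i] for [j <= i] and
    [nu - mu_i] for [nu] an eigenvalue of [J] on the quotient by the range of
    [P_i]. So stability of the [B_i] forces [mu_i] to dominate all later
    eigenvalues, i.e. [mu_i = lambda_i], which pins the flag down to the spans of
    the [w_j]; stability of the first block then says that exactly
    [lambda_1, ..., lambda_k] are positive. *)

(** * Derivatives of matrix-valued maps *)

Section MatrixNorm.
Variable R : rcfType.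

Lemma mxnorm_ge0 p q (A : 'M[R]_(p, q)) : 0 <= mxnorm A.
Proof. by apply: bigmax_ge_id. Qed.

Lemma le_mxnorm p q (A : 'M[R]_(p, q)) i j : `|A i j| <= mxnorm A.
Proof.
apply: le_trans (le_bigmax _ (fun i => \big[Num.max/0]_j `|A i j|) i).
exact: (le_bigmax _ (fun j => `|A i j|)).
Qed.

Lemma mxnorm_le p q (A : 'M[R]_(p, q)) c :
  0 <= c -> (forall i j, `|A i j| <= c) -> mxnorm A <= c.
Proof. by move=> c0 Ac; do 2!apply: bigmax_le => // ? _. Qed.

Lemma mxnorm_eq0 p q (A : 'M[R]_(p, q)) : mxnorm A <= 0 -> A = 0.
Proof.
move=> A0; apply/matrixP=> i j; rewrite mxE; apply/normr0_eq0/le_anti.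
by rewrite normr_ge0 (le_trans (le_mxnorm A i j)).
Qed.

Lemma mxnorm0 p q : mxnorm (0 : 'M[R]_(p, q)) = 0.
Proof.
by apply/le_anti; rewrite mxnorm_ge0 mxnorm_le // => i j; rewrite mxE normr0.
Qed.

Lemma mxnormD p q (A B : 'M[R]_(p, q)) : mxnorm (A + B) <= mxnorm A + mxnorm B.
Proof.
apply: mxnorm_le => [|i j]; first by rewrite addr_ge0 ?mxnorm_ge0.
by rewrite mxE (le_trans (ler_normD _ _)) // lerD ?le_mxnorm.
Qed.

Lemma mxnormZ_le p q a (A : 'M[R]_(p, q)) : mxnorm (a *: A) <= `|a| * mxnorm A.
Proof.
apply: mxnorm_le => [|i j]; first by rewrite mulr_ge0 ?mxnorm_ge0.
by rewrite mxE normrM ler_wpM2l ?le_mxnorm.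
Qed.

Lemma mxnormZ p q a (A : 'M[R]_(p, q)) : mxnorm (a *: A) = `|a| * mxnorm A.
Proof.
have [->|a0] := eqVneq a 0; first by rewrite scale0r mxnorm0 normr0 mul0r.
apply/le_anti; rewrite mxnormZ_le /=.
rewrite -ler_pdivlMl ?normr_gt0 // -normfV.
by rewrite -[A in leLHS](scalerK a0) mxnormZ_le.
Qed.

(** The max-entry norm is not submultiplicative: an entry of the product is a sum of [q] terms,
    hence the factor. *)
Lemma mxnormM p q r (A : 'M[R]_(p, q)) (B : 'M[R]_(q, r)) :
  mxnorm (A *m B) <= q%:R * mxnorm A * mxnorm B.
Proof.
apply: mxnorm_le => [|i j]; first by rewrite !mulr_ge0 ?mxnorm_ge0.
rewrite mxE (le_trans (ler_norm_sum _ _ _)) //.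
apply: (@le_trans _ _ (\sum_(k < q) mxnorm A * mxnorm B)).
  by apply: ler_sum => k _; rewrite normrM ler_pM ?le_mxnorm.
by rewrite sumr_const card_ord -mulrA mulr_natl.
Qed.

Lemma mxnorm_sum p q I (s : seq I) (P : pred I) (A : I -> 'M[R]_(p, q)) :
  mxnorm (\sum_(i <- s | P i) A i) <= \sum_(i <- s | P i) mxnorm (A i).
Proof.
elim/big_rec2: _ => [|i b A' _ IH]; first by rewrite mxnorm0.
by rewrite (le_trans (mxnormD _ _)) // lerD2l.
Qed.

Lemma mxnorm_tr_vec p q (A : 'M[R]_(p, q)) : mxnorm (mxvec A)^T = mxnorm A.
Proof.
apply/le_anti/andP; split; apply: mxnorm_le (mxnorm_ge0 _) _ => i j.
  by rewrite mxE ord1; case/mxvec_indexP: i => k l; rewrite mxvecE le_mxnorm.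
by have := le_mxnorm (mxvec A)^T (mxvec_index i j) 0; rewrite mxE mxvecE.
Qed.

End MatrixNorm.

(** * Remainder estimates and differentiation rules *)

Section Derivative.
Variables (R : rcfType) (N : nat).
Implicit Types (s h : 'cV[R]_N).

Definition small p q (r : 'cV[R]_N -> 'M[R]_(p, q)) : Prop :=
  forall eps : R, 0 < eps -> exists2 d : R, 0 < d &
    forall h, mxnorm h < d -> mxnorm (r h) <= eps * mxnorm h.

Definition bigO1 p q (r : 'cV[R]_N -> 'M[R]_(p, q)) : Prop :=
  exists2 c : R, 0 < c & exists2 d : R, 0 < d &
    forall h, mxnorm h < d -> mxnorm (r h) <= c * mxnorm h.

Definition locally_bounded p q (r : 'cV[R]_N -> 'M[R]_(p, q)) : Prop :=
  exists2 c : R, 0 < c & exists2 d : R, 0 < d &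
    forall h, mxnorm h < d -> mxnorm (r h) <= c.

(** The derivative is kept as a linear function, so that the product rule for matrices needs no
    vectorization; [mx_deriv_is_deriv] converts it to a matrix. *)
Definition mx_deriv p q (f : 'cV[R]_N -> 'M[R]_(p, q)) s
    (l : 'cV[R]_N -> 'M[R]_(p, q)) : Prop :=
  linear l /\ small (fun h => f (s + h) - f s - l h).

Lemma small_ext p q (r r' : 'cV[R]_N -> 'M[R]_(p, q)) :
  r =1 r' -> small r -> small r'.
Proof.
move=> rr' sr eps /sr[d d0 dP]; exists d => // h hd; rewrite -rr'; exact: dP.
Qed.

Lemma small0 p q : small (fun _ => 0 : 'M[R]_(p, q)).
Proof.
move=> eps e0; exists 1; first exact: ltr01.
by move=> h _; rewrite mxnorm0 mulr_ge0 ?mxnorm_ge0 // ltW.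
Qed.

Lemma smallD p q (r1 r2 : 'cV[R]_N -> 'M[R]_(p, q)) :
  small r1 -> small r2 -> small (fun h => r1 h + r2 h).
Proof.
move=> s1 s2 eps e0; have e2 : 0 < eps / 2 by lra.
have [d1 d10 d1P] := s1 _ e2; have [d2 d20 d2P] := s2 _ e2.
exists (Num.min d1 d2) => [|h]; first by rewrite lt_min d10.
rewrite lt_min => /andP[/d1P h1 /d2P h2]; have := mxnormD (r1 h) (r2 h); lra.
Qed.

Lemma small_bigO1 p q (r : 'cV[R]_N -> 'M[R]_(p, q)) : small r -> bigO1 r.
Proof. by move=> /(_ _ ltr01) ?; exists 1; rewrite ?ltr01. Qed.

Lemma bigO1_bounded p q (r : 'cV[R]_N -> 'M[R]_(p, q)) :
  bigO1 r -> locally_bounded r.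
Proof.
move=> [c c0 [d d0 dP]]; exists (c * d); first exact: mulr_gt0.
exists d => // h hd; apply: le_trans (dP _ hd) _.
by rewrite ler_wpM2l ?ltW.
Qed.

Lemma locally_boundedD p q (r1 r2 : 'cV[R]_N -> 'M[R]_(p, q)) :
  locally_bounded r1 -> locally_bounded r2 ->
  locally_bounded (fun h => r1 h + r2 h).
Proof.
move=> [c1 c10 [d1 d10 d1P]] [c2 c20 [d2 d20 d2P]].
exists (c1 + c2); first exact: addr_gt0.
exists (Num.min d1 d2) => [|h]; first by rewrite lt_min d10.
rewrite lt_min => /andP[/d1P h1 /d2P h2].
by rewrite (le_trans (mxnormD _ _)) // lerD.
Qed.

Lemma locally_bounded_cst p q (A : 'M[R]_(p, q)) :
  locally_bounded (fun _ => A).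
Proof.
exists (mxnorm A + 1); first by have := mxnorm_ge0 A; lra.
by exists 1 => [|h _]; [exact: ltr01|lra].
Qed.

Lemma smallMr p q t (r : 'cV[R]_N -> 'M[R]_(p, q))
    (b : 'cV[R]_N -> 'M[R]_(q, t)) :
  small r -> locally_bounded b -> small (fun h => r h *m b h).
Proof.
move=> sr [c c0 [d d0 dP]] eps e0.
(* Using [q + 1] in place of [q] keeps the denominator positive when [q = 0]. *)
have q1 : 0 < q%:R + 1 :> R by rewrite ltr_wpDl.
have e' : 0 < eps / ((q%:R + 1) * c) by rewrite divr_gt0 ?mulr_gt0.
have [d1 d10 d1P] := sr _ e'.
exists (Num.min d d1) => [|h]; first by rewrite lt_min d0.
rewrite lt_min => /andP[/dP h1 /d1P h2]; rewrite (le_trans (mxnormM _ _)) //.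
apply: (@le_trans _ _ ((q%:R + 1) * (eps / ((q%:R + 1) * c) * mxnorm h) * c)).
  rewrite ler_pM ?mulr_ge0 ?mxnorm_ge0 // ler_pM ?mxnorm_ge0 // lerDl ler01 //.
rewrite le_eqVlt; apply/orP; left; apply/eqP; field.
by rewrite !gt_eqF.
Qed.

Lemma smallMl p q t (b : 'cV[R]_N -> 'M[R]_(p, q))
    (r : 'cV[R]_N -> 'M[R]_(q, t)) :
  small r -> locally_bounded b -> small (fun h => b h *m r h).
Proof.
move=> sr [c c0 [d d0 dP]] eps e0.
have q1 : 0 < q%:R + 1 :> R by rewrite ltr_wpDl.
have e' : 0 < eps / ((q%:R + 1) * c) by rewrite divr_gt0 ?mulr_gt0.
have [d1 d10 d1P] := sr _ e'.
exists (Num.min d d1) => [|h]; first by rewrite lt_min d0.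
rewrite lt_min => /andP[/dP h1 /d1P h2]; rewrite (le_trans (mxnormM _ _)) //.
apply: (@le_trans _ _ ((q%:R + 1) * c * (eps / ((q%:R + 1) * c) * mxnorm h))).
  rewrite ler_pM ?mulr_ge0 ?mxnorm_ge0 // ler_pM ?mxnorm_ge0 // lerDl ler01 //.
rewrite le_eqVlt; apply/orP; left; apply/eqP; field.
by rewrite !gt_eqF.
Qed.

Lemma bigO1M_small p q t (r1 : 'cV[R]_N -> 'M[R]_(p, q))
    (r2 : 'cV[R]_N -> 'M[R]_(q, t)) :
  bigO1 r1 -> bigO1 r2 -> small (fun h => r1 h *m r2 h).
Proof.
move=> [c1 c10 [d1 d10 d1P]] [c2 c20 [d2 d20 d2P]] eps e0.
have q1 : 0 < q%:R + 1 :> R by rewrite ltr_wpDl.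
have C0 : 0 < (q%:R + 1) * c1 * c2 by rewrite !mulr_gt0.
exists (Num.min (eps / ((q%:R + 1) * c1 * c2)) (Num.min d1 d2)) => [|h].
  by rewrite !lt_min d10 d20 divr_gt0.
rewrite !lt_min => /and3P[h0 /d1P h1 /d2P h2].
rewrite (le_trans (mxnormM _ _)) //.
apply: (@le_trans _ _ ((q%:R + 1) * (c1 * mxnorm h) * (c2 * mxnorm h))).
  rewrite ler_pM ?mulr_ge0 ?mxnorm_ge0 // ler_pM ?mxnorm_ge0 // lerDl ler01 //.
have -> : (q%:R + 1) * (c1 * mxnorm h) * (c2 * mxnorm h) =
  (q%:R + 1) * c1 * c2 * mxnorm h * mxnorm h by ring.
by rewrite ler_wpM2r ?mxnorm_ge0 // -ler_pdivlMl // mulrC ltW.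
Qed.

Lemma linear_bigO1 p q (l : 'cV[R]_N -> 'M[R]_(p, q)) : linear l -> bigO1 l.
Proof.
move=> ll; set L : {linear _ -> _} := HB.pack l (GRing.isLinear.Build _ _ _ _ l ll).
have lE h : l h = \sum_i h i 0 *: l (delta_mx i 0).
  rewrite {1}[h]matrix_sum_delta -[l _]/(L _) linear_sum.
  by apply: eq_bigr => i _; rewrite big_ord1 linearZ.
set c := \sum_i mxnorm (l (delta_mx i 0)).
have c0 : 0 <= c by rewrite sumr_ge0 // => i _; exact: mxnorm_ge0.
exists (c + 1); first by rewrite ltr_wpDl.
exists 1 => [|h _]; first exact: ltr01.
apply: (@le_trans _ _ (c * mxnorm h)); last first.
  by rewrite ler_wpM2r ?mxnorm_ge0 // lerDl ler01.
rewrite lE (le_trans (mxnorm_sum _ _ _)) // mulr_suml ler_sum // => i _.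
by rewrite mxnormZ mulrC ler_wpM2l ?mxnorm_ge0 // le_mxnorm.
Qed.

Lemma mx_deriv_cst p q (A : 'M[R]_(p, q)) s : mx_deriv (fun _ => A) s (fun _ => 0).
Proof.
split=> [a u v|]; first by rewrite scaler0 addr0.
by apply: small_ext (@small0 _ _) => h; rewrite subrr subr0.
Qed.

Lemma mx_deriv_linear p q (l : 'cV[R]_N -> 'M[R]_(p, q)) s :
  linear l -> mx_deriv l s l.
Proof.
move=> ll; split=> //; apply: small_ext (@small0 _ _) => h.
have := ll 1 s h; rewrite !scale1r => ->; by rewrite [l s + _]addrC addrK subrr.
Qed.

Lemma mx_derivD p q (f g : 'cV[R]_N -> 'M[R]_(p, q)) s lf lg :
  mx_deriv f s lf -> mx_deriv g s lg ->
  mx_deriv (fun x => f x + g x) s (fun h => lf h + lg h).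
Proof.
move=> [llf sf] [llg sg]; split=> [a u v|].
  by rewrite llf llg scalerDr addrACA.
apply: small_ext (smallD sf sg) => h /=.
by apply/matrixP=> i j; rewrite !mxE; ring.
Qed.

Lemma mx_derivN p q (f : 'cV[R]_N -> 'M[R]_(p, q)) s lf :
  mx_deriv f s lf -> mx_deriv (fun x => - f x) s (fun h => - lf h).
Proof.
move=> [llf sf]; split=> [a u v|]; first by rewrite llf opprD scalerN.
move=> eps /sf[d d0 dP]; exists d => // h hd.
by rewrite -!opprD -[- _]scaleN1r mxnormZ normrN1 mul1r; apply: dP.
Qed.

Lemma mx_derivB p q (f g : 'cV[R]_N -> 'M[R]_(p, q)) s lf lg :
  mx_deriv f s lf -> mx_deriv g s lg ->
  mx_deriv (fun x => f x - g x) s (fun h => lf h - lg h).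
Proof. by move=> df dg; apply: mx_derivD df (mx_derivN dg). Qed.

Lemma mx_deriv_sum p q I (r : seq I) (P : pred I)
    (f l : I -> 'cV[R]_N -> 'M[R]_(p, q)) s :
  (forall i, P i -> mx_deriv (f i) s (l i)) ->
  mx_deriv (fun x => \sum_(i <- r | P i) f i x) s
           (fun h => \sum_(i <- r | P i) l i h).
Proof.
move=> df; split=> [a u v|].
  rewrite scaler_sumr -big_split /=.
  by apply: eq_bigr => i /df[->].
apply: (@small_ext _ _
    (fun h => \sum_(i <- r | P i) (f i (s + h) - f i s - l i h))).
  by move=> h; rewrite !sumrB.
elim: r => [|i r IH].
  by apply: small_ext (@small0 _ _) => h; rewrite big_nil.
case Pi: (P i); last first.
  by apply: small_ext IH => h; rewrite big_cons Pi.
by apply: small_ext (smallD (df i Pi).2 IH) => h; rewrite big_cons Pi.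
Qed.

Lemma mx_derivM p q t (f : 'cV[R]_N -> 'M[R]_(p, q))
    (g : 'cV[R]_N -> 'M[R]_(q, t)) s lf lg :
  mx_deriv f s lf -> mx_deriv g s lg ->
  mx_deriv (fun x => f x *m g x) s (fun h => lf h *m g s + f s *m lg h).
Proof.
move=> [llf sf] [llg sg]; split=> [a u v|].
  by rewrite llf llg mulmxDl mulmxDr -scalemxAl -scalemxAr scalerDr addrACA.
have Of := linear_bigO1 llf; have Og := linear_bigO1 llg.
have bg : locally_bounded (fun h => g s + (lg h + (g (s + h) - g s - lg h))).
  apply: locally_boundedD (locally_bounded_cst _) _.
  apply: locally_boundedD (bigO1_bounded Og) _.
  exact/bigO1_bounded/small_bigO1.
have bf : locally_bounded (fun h => f s + lf h).
  exact: locally_boundedD (locally_bounded_cst _) (bigO1_bounded Of).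
(* With [r_f], [r_g] the remainders of [f], [g], the remainder of the product is [r_f g(s + h) +
   (f(s) + lf h) r_g + lf h lg h]. *)
have := smallD (smallD (smallMr sf bg) (smallMl sg bf)) (bigO1M_small Of Og).
apply: small_ext => h.
set F := f (s + h); set G := g (s + h).
have -> : g s + (lg h + (G - g s - lg h)) = G.
  by apply/matrixP=> i j; rewrite !mxE; ring.
rewrite !(mulmxBl, mulmxDl, mulmxBr, mulmxDr).
repeat match goal with |- context [?A *m ?B] => move: (A *m B) => ? end.
by apply/matrixP=> i j; rewrite !mxE; ring.
Qed.

Lemma mx_deriv_tr p q (f : 'cV[R]_N -> 'M[R]_(p, q)) s lf :
  mx_deriv f s lf -> mx_deriv (fun x => (f x)^T) s (fun h => (lf h)^T).
Proof.
move=> [llf sf]; split=> [a u v|]; first by rewrite llf linearP.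
move=> eps e0; have [d d0 dP] := sf _ e0; exists d => // h /dP hd.
rewrite -!linearB /=; apply: le_trans hd; apply: mxnorm_le (mxnorm_ge0 _) _ => i j.
by rewrite mxE le_mxnorm.
Qed.

Lemma mx_deriv_is_deriv p (f : 'cV[R]_N -> 'cV[R]_p) s l :
  mx_deriv f s l -> exists2 L, is_deriv f s L & forall h, l h = L *m h.
Proof.
move=> [ll sl]; set L : {linear _ -> _} := HB.pack l (GRing.isLinear.Build _ _ _ _ l ll).
pose M : 'M[R]_(p, N) := \matrix_(i, j) l (delta_mx j 0) i 0.
have lE h : l h = M *m h.
  rewrite {1}[h]matrix_sum_delta -[l _]/(L _) linear_sum.
  apply/matrixP=> i j; rewrite ord1 summxE mxE; apply: eq_bigr => k _.
  by rewrite big_ord1 linearZ !mxE mulrC.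
exists M => // eps /sl[d d0 dP]; exists d => // h /dP; by rewrite lE.
Qed.

(** Two remainders of order o(h) bound [(L - L') h] by [eps |h|] for small [h], hence for all [h] by
    homogeneity, and [eps] is arbitrary. *)
Lemma is_deriv_unique p (f : 'cV[R]_N -> 'cV[R]_p) s L L' :
  is_deriv f s L -> is_deriv f s L' -> L = L'.
Proof.
move=> dL dL'.
have key eps h : 0 < eps -> mxnorm ((L - L') *m h) <= eps * mxnorm h.
  move=> e0; have e2 : 0 < eps / 2 by lra.
  have [d d0 dP] := dL _ e2; have [d' d'0 d'P] := dL' _ e2.
  have n0 := mxnorm_ge0 h; have n1 : 0 < mxnorm h + 1 by lra.
  (* This factor scales [h] into both balls; the added 1 covers [h = 0]. *)
  pose t := Num.min d d' / (mxnorm h + 1).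
  have m0 : 0 < Num.min d d' by rewrite lt_min d0.
  have t0 : 0 < t by rewrite divr_gt0.
  have : mxnorm (t *: h) < Num.min d d'.
    by rewrite mxnormZ gtr0_norm // mulrAC ltr_pdivrMr // ltr_pM2l // ltrDl ltr01.
  rewrite lt_min => /andP[/dP h1 /d'P h2].
  have : mxnorm ((L - L') *m (t *: h)) <= eps * mxnorm (t *: h).
    have -> : (L - L') *m (t *: h) = (f (s + t *: h) - f s - L' *m (t *: h)) +
        (-1) *: (f (s + t *: h) - f s - L *m (t *: h)).
      rewrite mulmxBl scaleN1r.
      move: (L *m _) (L' *m _) => u v; apply/matrixP=> i j; rewrite !mxE; ring.
    rewrite (le_trans (mxnormD _ _)) // mxnormZ normrN1 mul1r; lra.
  rewrite -scalemxAr !mxnormZ gtr0_norm // mulrCA ler_pM2l //.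
apply/subr0_eq/matrixP=> i j.
have -> : (L - L') i j = ((L - L') *m (delta_mx j 0 : 'cV_N)) i 0.
  by rewrite -colE [RHS]mxE.
rewrite [(L - L') *m _](_ : _ = 0) ?mxE //; apply/mxnorm_eq0/ler_addgt0Pl => e e0.
rewrite addr0; have n0 := mxnorm_ge0 (delta_mx j 0 : 'cV[R]_N).
have n1 : 0 < mxnorm (delta_mx j 0 : 'cV[R]_N) + 1 by lra.
apply: le_trans (key (e / (mxnorm (delta_mx j 0 : 'cV[R]_N) + 1)) _ _) _.
  by rewrite divr_gt0.
by rewrite mulrAC ler_pdivrMr // ler_pM2l // lerDl ler01.
Qed.

Lemma mx_deriv_ext p q (f f' l l' : 'cV[R]_N -> 'M[R]_(p, q)) s :
  f =1 f' -> l =1 l' -> mx_deriv f s l -> mx_deriv f' s l'.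
Proof.
move=> ff' ll' [fl sf]; split=> [a u v|]; first by rewrite -!ll' fl.
by apply: small_ext sf => h; rewrite -!ff' ll'.
Qed.

Lemma mx_derivMl p q t (A : 'M[R]_(p, q)) (g : 'cV[R]_N -> 'M[R]_(q, t)) s lg :
  mx_deriv g s lg -> mx_deriv (fun x => A *m g x) s (fun h => A *m lg h).
Proof.
move=> dg; apply: mx_deriv_ext (mx_derivM (mx_deriv_cst A s) dg) => // h /=.
by rewrite mul0mx add0r.
Qed.

Lemma mx_derivZ p q a (g : 'cV[R]_N -> 'M[R]_(p, q)) s lg :
  mx_deriv g s lg -> mx_deriv (fun x => a *: g x) s (fun h => a *: lg h).
Proof.
move=> /(mx_derivMl a%:M); apply: mx_deriv_ext => h; by rewrite mul_scalar_mx.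
Qed.

Lemma mx_deriv_col p1 p2 q (f : 'cV[R]_N -> 'M[R]_(p1, q))
    (g : 'cV[R]_N -> 'M[R]_(p2, q)) s lf lg :
  mx_deriv f s lf -> mx_deriv g s lg ->
  mx_deriv (fun x => col_mx (f x) (g x)) s (fun h => col_mx (lf h) (lg h)).
Proof.
move=> df dg; have := mx_derivD (mx_derivMl (col_mx 1%:M 0) df)
  (mx_derivMl (col_mx 0 1%:M) dg).
by apply: mx_deriv_ext => h;
  rewrite !mul_col_mx !mul0mx !mul1mx add_col_mx addr0 add0r.
Qed.

Lemma mx_deriv_tr_vec p q (f : 'cV[R]_N -> 'M[R]_(p, q)) s lf :
  mx_deriv f s lf -> mx_deriv (fun x => (mxvec (f x))^T) s (fun h => (mxvec (lf h))^T).
Proof.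
move=> [llf sf]; split=> [a u v|]; first by rewrite llf !linearP.
move=> eps e0; have [d d0 dP] := sf _ e0; exists d => // h /dP.
by rewrite -mxnorm_tr_vec !linearB.
Qed.

Lemma mx_deriv_vec_mx p q (f : 'cV[R]_N -> 'cV[R]_(p * q)) s lf :
  mx_deriv f s lf -> mx_deriv (fun x => vec_mx (f x)^T) s (fun h => vec_mx (lf h)^T).
Proof.
move=> [llf sf]; split=> [a u v|]; first by rewrite llf !linearP.
move=> eps e0; have [d d0 dP] := sf _ e0; exists d => // h /dP.
by rewrite -!linearB /= -[mxnorm (vec_mx _)]mxnorm_tr_vec vec_mxK trmxK.
Qed.

Lemma mx_deriv_rows p q (f l : 'I_p -> 'cV[R]_N -> 'cV[R]_q) s :
  (forall i, mx_deriv (f i) s (l i)) ->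
  mx_deriv (fun x => \matrix_(i < p) (f i x)^T) s (fun h => \matrix_(i < p) (l i h)^T).
Proof.
move=> df.
have E (g : 'I_p -> 'cV[R]_N -> 'cV[R]_q) h :
    \sum_i delta_mx i (0 : 'I_1) *m (g i h)^T = \matrix_(i < p) (g i h)^T.
  apply/matrixP=> a b; rewrite summxE (bigD1 a) //= big1 ?addr0 => [|i ia].
    by rewrite !mxE big_ord1 !mxE !eqxx mul1r.
  by rewrite mxE big_ord1 !mxE eq_sym (negPf ia) mul0r.
apply: mx_deriv_ext (E f) (E l) _.
by apply: mx_deriv_sum => i _; apply: mx_derivMl; apply: mx_deriv_tr.
Qed.

Lemma is_deriv_mx_deriv p (f : 'cV[R]_N -> 'cV[R]_p) s L :
  is_deriv f s L -> mx_deriv f s (mulmx L).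
Proof. by move=> dL; split=> // a u v; rewrite linearP. Qed.

End Derivative.

Lemma mx_deriv_comp_usub (R : rcfType) n m p q (f : 'cV[R]_n -> 'M[R]_(p, q))
    (s : 'cV[R]_(n + m)) l :
  mx_deriv f (usubmx s) l ->
  mx_deriv (fun x : 'cV[R]_(n + m) => f (usubmx x)) s (fun h => l (usubmx h)).
Proof.
move=> [ll sl]; split=> [a u v|]; first by rewrite linearP /= ll.
move=> eps e0; have [d d0 dP] := sl _ e0; exists d => // h hd.
have hu : mxnorm (usubmx h) <= mxnorm h.
  by apply: mxnorm_le (mxnorm_ge0 _) _ => i j; rewrite mxE le_mxnorm.
rewrite linearD /=; apply: le_trans (dP _ (le_lt_trans hu hd)) _.
by rewrite ler_wpM2l // ltW.
Qed.

(** * Characteristic polynomials and invariant subspaces *)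

Section CharPoly.
Variable F : fieldType.

Lemma char_poly_tr n (A : 'M[F]_n) : char_poly A^T = char_poly A.
Proof.
rewrite /char_poly -[RHS]det_tr; congr (\det _).
by rewrite /char_poly_mx linearB /= tr_scalar_mx map_trmx.
Qed.

Lemma char_poly_lblock m r (A : 'M[F]_m) (C : 'M_(r, m)) (D : 'M_r) :
  char_poly (block_mx A 0 C D) = char_poly A * char_poly D.
Proof.
rewrite /char_poly -(det_lblock _ (- map_mx polyC C)); congr (\det _).
rewrite /char_poly_mx map_block_mx map_mx0 scalar_mx_block.
by rewrite opp_block_mx add_block_mx oppr0 addr0 sub0r.
Qed.

(** The sizes may differ syntactically, as for a stacked matrix; invertibility forces [m = n]. Then
    [S (X - A) = (X - B) S], and the nonzero determinant of [S] cancels. *)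
Lemma char_poly_conj m n (S : 'M[F]_(m, n)) (T : 'M_(n, m)) A B :
  S *m T = 1%:M -> T *m S = 1%:M -> S *m A = B *m S -> char_poly A = char_poly B.
Proof.
move=> ST TS; have mn : m = n.
  by apply/eqP; rewrite eqn_leq (mulmx1_min ST) (mulmx1_min TS).
move: S T ST TS A B; rewrite mn => S T ST TS A B SAB.
have dS : \det (map_mx polyC S) != 0.
  rewrite det_map_mx polyC_eq0; have [uS _] := mulmx1_unit ST.
  by rewrite -unitfE -unitmxE.
apply: (mulfI dS); rewrite [RHS]mulrC -!det_mulmx; congr (\det _).
rewrite /char_poly_mx mulmxBr mulmxBl -!map_mxM /= SAB.
by rewrite scalar_mxC.
Qed.

(** A monic divisor of a split polynomial is the product over a sublist of [t]; unique factorization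
    gives the permutation. *)
Lemma prod_XsubC_cancel (s t : seq F) (p : {poly F}) : p \is monic ->
  \prod_(c <- t) ('X - c%:P) = \prod_(c <- s) ('X - c%:P) * p ->
  exists2 s', p = \prod_(c <- s') ('X - c%:P) & perm_eq (s ++ s') t.
Proof.
move=> pm e; have : p %| \prod_(c <- t) ('X - c%:P) by rewrite e dvdp_mull.
move=> /dvdp_prod_XsubC[m]; rewrite eqp_monic ?monic_prod_XsubC // => /eqP pE.
exists (mask m t) => //; apply: prod_XsubC_eq; rewrite big_cat /= e.
by rewrite -pE.
Qed.

(* [V] spans a [K]-invariant space of rows, [N] its orthogonal complement, and
   [D] is the matrix of [K] on the quotient. *)
Lemma invariant_split n m (K : 'M[F]_n) (V : 'M_(m, n)) (L : 'M_m) :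
  V *m V^T = 1%:M -> V *m K = L *m V ->
  exists r (N : 'M_(r, n)) (G : 'M_(n, r)) (D : 'M_r),
  [/\ [/\ N *m V^T = 0, V *m G = 0, N *m G = 1%:M & V^T *m V + G *m N = 1%:M],
      K *m G = G *m D,
      char_poly K = char_poly L * char_poly D,
      char_poly (K *m (1%:M - 2%:R *: (V^T *m V))) = char_poly (- L) * char_poly D &
      forall c, char_poly (K - (K + K^T) *m (V^T *m V) - c%:M) =
        char_poly (- L^T - c%:M) * char_poly (D - c%:M)].
Proof.
move=> VV VK; pose N := row_base (kermx V^T).
have NV : N *m V^T = 0 by apply/sub_kermxP; rewrite eq_row_base.
have sN : (1%:M - V^T *m V <= N)%MS.
  rewrite eq_row_base; apply/sub_kermxP.
  by rewrite mulmxBl mul1mx -mulmxA VV mulmx1 subrr.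
(* This [G] is the right inverse of [N] that is annihilated by [V]; [G N] is the orthogonal
   projection along the rows of [V]. *)
pose G := (1%:M - V^T *m V) *m pinvmx N.
have GN : G *m N = 1%:M - V^T *m V by rewrite /G mulmxKpV.
have fN : row_free N by exact: row_base_free.
have NG : N *m G = 1%:M.
  apply: (row_free_inj fN); rewrite mul1mx -mulmxA GN mulmxBr mulmx1 mulmxA NV.
  by rewrite mul0mx subr0.
have VG : V *m G = 0.
  apply: (row_free_inj fN); rewrite mul0mx -mulmxA GN mulmxBr mulmx1 mulmxA VV.
  by rewrite mul1mx subrr.
have E1 : V^T *m V + G *m N = 1%:M by rewrite GN addrC subrK.
pose D := N *m K *m G; pose X := N *m K *m V^T.
have KG : K *m G = G *m D.
  rewrite -[K *m G]mul1mx -E1 mulmxDl -!mulmxA [V *m (K *m G)]mulmxA VK.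
  by rewrite -[L *m V *m G]mulmxA VG !mulmx0 add0r /D !mulmxA.
have NK : N *m K = X *m V + D *m N.
  by rewrite -[N *m K]mulmx1 -E1 mulmxDr !mulmxA.
clearbody D X G N.
exists _, N, G, D.
(* [S] and [T] are mutually inverse. In these coordinates an operator preserving the row space of
   [V] is block lower triangular, which is what [conj] exploits. *)
pose S := col_mx V N; pose T := row_mx V^T G.
have ST : S *m T = 1%:M.
  by rewrite mul_col_row VV VG NV NG -scalar_mx_block.
have TS : T *m S = 1%:M by rewrite mul_row_col.
have conj A L' X' D' : V *m A = L' *m V -> N *m A = X' *m V + D' *m N ->
    char_poly A = char_poly L' * char_poly D'.
  move=> VA NA; rewrite -(char_poly_lblock _ X'); apply: (char_poly_conj ST TS).
  by rewrite mul_col_mx mul_block_col VA NA mul0mx addr0.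
have VP : V *m (V^T *m V) = V by rewrite mulmxA VV mul1mx.
have NP : N *m (V^T *m V) = 0 by rewrite mulmxA NV mul0mx.
have VKT : V *m K^T *m V^T = L^T.
  by apply: trmx_inj; rewrite !trmx_mul !trmxK mulmxA VK -mulmxA VV mulmx1.
have NKT : N *m K^T *m V^T = 0.
  by rewrite -mulmxA -trmx_mul VK trmx_mul mulmxA NV mul0mx.
split=> //; first exact: conj VK NK.
(* Multiplying by [1 - 2 V^T V] on the right reverses the [V] component and fixes the [N] component:
   the blocks become [- L], [- X], [D]. *)
- apply: (@conj _ _ (- X)); rewrite mulmxA.
    rewrite VK -mulmxA mulmxBr mulmx1 -scalemxAr VP mulmxBr -scalemxAr mulNmx.
    by rewrite scaler_nat mulr2n opprD addrA subrr sub0r.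
  rewrite NK mulmxBr mulmx1 -scalemxAr mulmxDl -!mulmxA VP NP mulmx0 addr0.
  by rewrite scaler_nat mulr2n mulNmx opprD addrACA subrr add0r addrC.
(* On the rows of [V] the subtracted term is [L V + L^T V], which leaves [- L^T V]; on the rows of
   [N] it is exactly the coupling [X V], which leaves [D N]. *)
- have VKP : V *m ((K + K^T) *m (V^T *m V)) = L *m V + L^T *m V.
    by rewrite mulmxDl mulmxDr !mulmxA VK VKT -[L *m V *m _]mulmxA VV mulmx1.
  have NKP : N *m ((K + K^T) *m (V^T *m V)) = X *m V.
    rewrite mulmxDl mulmxDr !mulmxA NKT mul0mx addr0 NK !mulmxDl.
    rewrite -[X *m V *m _]mulmxA VV -[D *m N *m _]mulmxA NV.
    by rewrite mulmx0 mul0mx mulmx1 addr0.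
  move=> c; apply: (@conj _ _ 0); rewrite !mulmxBr mulmxBl mul_mx_scalar mul_scalar_mx.
    by rewrite VK VKP opprD addrA subrr sub0r mulNmx.
  by rewrite NK NKP mul0mx add0r [X *m V + _]addrC addrK.
Qed.

Lemma invariant_spectrum n m (K : 'M[F]_n) (V : 'M_(m, n)) (L : 'M_m) (t : seq F) :
  V *m V^T = 1%:M -> V *m K = L *m V -> is_trig_mx L ->
  char_poly K = \prod_(c <- t) ('X - c%:P) ->
  exists r (N : 'M_(r, n)) (G : 'M_(n, r)) (D : 'M_r) (s : seq F),
  [/\ [/\ N *m V^T = 0, V *m G = 0, N *m G = 1%:M & V^T *m V + G *m N = 1%:M],
      [/\ K *m G = G *m D, char_poly D = \prod_(c <- s) ('X - c%:P) &
       perm_eq ([seq L i i | i <- enum 'I_m] ++ s) t],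
      char_poly (K *m (1%:M - 2%:R *: (V^T *m V))) =
        \prod_(c <- [seq - L i i | i <- enum 'I_m] ++ s) ('X - c%:P) &
      forall c, char_poly (K - (K + K^T) *m (V^T *m V) - c%:M) =
        \prod_(x <- [seq - L i i - c | i <- enum 'I_m] ++ [seq x - c | x <- s])
           ('X - x%:P)].
Proof.
move=> VV VK Lt Kt.
have [r [N [G [D [NG KG cK cA cB]]]]] := invariant_split VV VK.
have LE (A : 'M[F]_m) : is_trig_mx A ->
    char_poly A = \prod_(c <- [seq A i i | i <- enum 'I_m]) ('X - c%:P).
  by move=> /char_poly_trig ->; rewrite big_map big_enum.
have [|s Ds st] := @prod_XsubC_cancel [seq L i i | i <- enum 'I_m] t (char_poly D)
  (char_poly_monic D).
  by rewrite -Kt cK LE.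
exists r, N, G, D, s; split=> //.
  rewrite cA big_cat /= Ds LE; last first.
    by apply/is_trig_mxP=> i j ij; rewrite mxE (is_trig_mxP Lt) ?oppr0.
  congr (_ * _); rewrite !big_map; apply: eq_bigr => i _; by rewrite mxE.
move=> c; rewrite cB big_cat /=; congr (_ * _).
  (* [- L^T - c] is upper triangular, so its transpose is taken before reading the diagonal. *)
  rewrite -char_poly_tr LE.
    by rewrite !big_map; apply: eq_bigr => i _; rewrite !mxE eqxx mulr1n.
  apply/is_trig_mxP=> i j ij; rewrite !mxE (is_trig_mxP Lt) //.
  by rewrite -val_eqE /= (gtn_eqF ij) mulr0n !oppr0 addr0.
(* Shifting a matrix by [- c] substitutes [X + c] in its characteristic polynomial. *)
have -> : char_poly (D - c%:M) = char_poly D \Po ('X + c%:P).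
  rewrite -[RHS](det_map_mx (comp_poly ('X + c%:P))); congr (\det _).
  apply/matrixP=> i j; rewrite !mxE !rmorphB /= !rmorphMn /= comp_polyX !comp_polyC.
  case: (i == j); rewrite ?mulr0n ?mulr1n ?rmorphB ?rmorph0 ?subr0 //=.
  by rewrite opprB [RHS]addrAC addrA [in RHS]addrAC.
rewrite Ds rmorph_prod big_map; apply: eq_bigr => x _ /=.
by rewrite comp_polyB comp_polyX comp_polyC polyCB opprB addrA addrAC.
Qed.

End CharPoly.

(** * Complex eigenvalues of real matrices with real spectrum *)

Section Spectrum.
Variable R : rcfType.

Lemma cplx_shift_mul m (A : 'M[R]_m) a b (u w : 'cV_m) :
  cplx_shift A a b *m col_mx u w =
  col_mx (A *m u - a *: u + b *: w) (A *m w - a *: w - b *: u).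
Proof.
rewrite /cplx_shift mul_block_col !mulmxBl mulNmx !mul_scalar_mx.
by rewrite [- _ + _]addrC.
Qed.

Lemma cplx_shift_eq0 m (A : 'M[R]_m) a b (u w : 'cV_m) :
  cplx_shift A a b *m col_mx u w = 0 ->
  A *m u - a *: u + b *: w = 0 /\ A *m w - a *: w - b *: u = 0.
Proof. by rewrite cplx_shift_mul -col_mx0 => /eq_col_mx. Qed.

(** If [b] is nonzero, [q = (X - a)^2 + b^2] has no real root and is coprime to the split
    characteristic polynomial. Both polynomials in [A] annihilate the real and imaginary parts of
    the eigenvector, so a Bezout relation makes it vanish. *)
Lemma cplx_eigenvalue_split m (A : 'M[R]_m) (s : seq R) a b :
  char_poly A = \prod_(c <- s) ('X - c%:P) ->
  cplx_eigenvalue A a b -> b = 0 /\ a \in s.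
Proof.
move=> As [z z0]; rewrite -[z]vsubmxK => /cplx_shift_eq0[].
set u := usubmx z; set w := dsubmx z => e1 e2.
have uw0 : (u != 0) || (w != 0).
  apply: contraNT z0; rewrite negb_or !negbK => /andP[/eqP u0 /eqP w0].
  by rewrite -[z]vsubmxK -/u -/w u0 w0 col_mx0.
clearbody u w; clear z z0.
have [b0|b0] := eqVneq b 0; last first.
  exfalso; case: m A As u w e1 e2 uw0 => [|m] A As u w e1 e2.
    by rewrite [u]flatmx0 [w]flatmx0 eqxx.
  pose q : {poly R} := ('X - a%:P) ^+ 2 + (b ^+ 2)%:P.
  have cpq : coprimep (char_poly A) q.
    rewrite As; elim: s {As} => [|c s IH]; first by rewrite big_nil coprime1p.
    rewrite big_cons coprimepMl IH andbT coprimep_sym coprimep_XsubC.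
    rewrite /root !hornerE; apply: lt0r_neq0.
    by rewrite ltr_wpDl ?sqr_ge0 // exprn_even_gt0.
  move: cpq => /Bezout_eq1_coprimepP[[p1' p2'] /= e].
  have qA (x y : 'cV_m.+1) : A *m x - a *: x + b *: y = 0 ->
      A *m y - a *: y - b *: x = 0 -> x = 0.
    move=> x1 x2; have : horner_mx A q *m x = 0.
      rewrite /q rmorphD rmorphXn rmorphB /= horner_mx_X !horner_mx_C.
      rewrite mulmxDl expr2 -mulmxE -mulmxA.
      have -> : (A - a%:M) *m x = - (b *: y).
        by rewrite mulmxBl mul_scalar_mx; apply/eqP; rewrite -addr_eq0 x1.
      rewrite mulmxN -scalemxAr.
      have -> : (A - a%:M) *m y = b *: x.
        by rewrite mulmxBl mul_scalar_mx; apply/eqP; rewrite -subr_eq0 x2.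
      by rewrite mul_scalar_mx scalerA -expr2 addNr.
    move=> qx; have := congr1 (horner_mx A) e.
    rewrite rmorphD !rmorphM /= Cayley_Hamilton mulr0 add0r rmorph1 => e'.
    by rewrite -[x]mul1mx -[1%:M]e' -mulmxE -mulmxA qx mulmx0.
  (* The imaginary part is handled by applying the same fact to [- i z = w - i u]. *)
  rewrite (qA _ _ e1 e2) (qA w (- u)) ?eqxx //.
    by rewrite scalerN.
  by rewrite mulmxN scalerN -!opprD e1 oppr0.
split=> //; move: e1 e2; rewrite b0 !scale0r addr0 subr0 => e1 e2.
have key (x : 'cV_m) : x != 0 -> A *m x - a *: x = 0 -> a \in s.
  move=> x0 /eqP; rewrite subr_eq0 => /eqP xA.
  rewrite -root_prod_XsubC -As -char_poly_tr -eigenvalue_root_char.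
  apply/eigenvalueP; exists x^T; last by rewrite trmx_eq0.
  by rewrite -trmx_mul xA linearZ.
by case/orP: uw0 => /key; apply.
Qed.

Lemma real_cplx_eigenvalue m (A : 'M[R]_m) a :
  root (char_poly A) a -> cplx_eigenvalue A a 0.
Proof.
rewrite -char_poly_tr -eigenvalue_root_char => /eigenvalueP[v vA v0].
exists (col_mx v^T 0); first by rewrite col_mx_eq0 trmx_eq0 (negPf v0).
rewrite cplx_shift_mul !scaler0 mulmx0 scale0r !subr0 addr0.
by rewrite -[A]trmxK -trmx_mul vA linearZ /= subrr col_mx0.
Qed.

Lemma all_eig_neg_split m (A : 'M[R]_m) (s : seq R) :
  char_poly A = \prod_(c <- s) ('X - c%:P) ->
  all_eig_neg_re A <-> (forall c, c \in s -> c < 0).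
Proof.
move=> As; split=> [neg c cs|neg a b /(cplx_eigenvalue_split As)[_ /neg]] //.
by apply: (neg c 0); apply: real_cplx_eigenvalue; rewrite As root_prod_XsubC.
Qed.

Lemma hyperbolic_split m (A : 'M[R]_m) (s : seq R) :
  char_poly A = \prod_(c <- s) ('X - c%:P) ->
  (forall c, c \in s -> c != 0) -> hyperbolic_mx A.
Proof. by move=> As s0 a b /(cplx_eigenvalue_split As)[_ /s0]. Qed.

Lemma all_eig_neg_inj m (A : 'M[R]_m) a b (z : 'cV_(m + m)) :
  all_eig_neg_re A -> 0 <= a -> cplx_shift A a b *m z = 0 -> z = 0.
Proof.
move=> neg a0 zA; apply/eqP/negPn/negP=> z0.
have /neg : cplx_eigenvalue A a b by exists z.
by rewrite ltNge a0.
Qed.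

End Spectrum.

(** * Flags and eigenvectors *)

Section Flags.
Variable F : fieldType.

Lemma trig_mulmx n (A B : 'M[F]_n) : is_trig_mx A -> is_trig_mx B ->
  is_trig_mx (A *m B) /\ forall i, (A *m B) i i = A i i * B i i.
Proof.
move=> /is_trig_mxP At /is_trig_mxP Bt; split=> [|i].
  apply/is_trig_mxP=> i j ij; rewrite mxE big1 // => l _.
  have [il|li] := ltnP i l; first by rewrite At // mul0r.
  by rewrite Bt ?mulr0 // (leq_ltn_trans li).
rewrite mxE (bigD1 i) //= big1 ?addr0 // => l li.
have [il|il] := ltnP i l; first by rewrite At // mul0r.
by rewrite Bt ?mulr0 // ltn_neqAle il andbT.
Qed.

(** Eigenspaces for distinct eigenvalues are in direct sum; a nonzero coefficient in a linear
    relation would place one eigenvector in the sum of the other eigenspaces. *)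
Lemma row_free_eigen n p (K : 'M[F]_n) (W : 'M_(p, n)) (d : 'I_p -> F) :
  injective d -> (forall i, row i W != 0 /\ row i W *m K = d i *: row i W) ->
  row_free W.
Proof.
move=> injd hW; rewrite -kermx_eq0; apply/eqP/row_matrixP=> l.
rewrite row0; set c := row l _.
have cW : c *m W = 0 by rewrite -row_mul mulmx_ker row0.
have /mxdirect_sumsP dir := @mxdirect_sum_eigenspace _ _ n K predT d (in2W injd).
have eW i : (row i W <= eigenspace K (d i))%MS.
  by apply/eigenspaceP; case: (hW i).
clearbody c; apply/rowP=> i; rewrite [RHS]mxE; apply/eqP/negPn/negP=> ci.
have [/negP Wi _] := hW i; apply: Wi; rewrite -submx0 -(dir i isT) sub_capmx eW /=.
move: cW; rewrite mulmx_sum_row (bigD1 i) //= => /eqP.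
rewrite addrC addr_eq0 => /eqP cW.
rewrite -[row i W]scale1r -(mulVf ci) -scalerA scalemx_sub //.
rewrite -[c 0 i *: _]opprK -cW eqmx_opp /= summx_sub // => j ji.
rewrite scalemx_sub // (submx_trans (eW j)) //.
by rewrite (sumsmx_sup j) // ji.
Qed.

(** * Leading rows and leading triangular blocks *)

Section Prefix.
Variables (n k : nat).
Definition top_rows (V : 'M[F]_(k, n)) m (hm : (m <= k)%N) : 'M[F]_(m, n) :=
  rowsub (widen_ord hm) V.

Lemma top_rows_ortho (V : 'M[F]_(k, n)) m (hm : (m <= k)%N) :
  V *m V^T = 1%:M -> top_rows V hm *m (top_rows V hm)^T = 1%:M.
Proof.
move=> /matrixP VV; apply/matrixP=> i j.
have := VV (widen_ord hm i) (widen_ord hm j); rewrite !mxE -val_eqE /= => <-.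
by apply: eq_bigr => l _; rewrite !mxE.
Qed.

Lemma top_submx_trig (L : 'M[F]_k) m (hm : (m <= k)%N) :
  is_trig_mx L -> is_trig_mx (mxsub (widen_ord hm) (widen_ord hm) L).
Proof. by move=> /is_trig_mxP Lt; apply/is_trig_mxP=> i j ij; rewrite mxE Lt. Qed.

Lemma top_rows_invariant (K : 'M[F]_n) (V : 'M[F]_(k, n)) (L : 'M_k) m (hm : (m <= k)%N) :
  V *m K = L *m V -> is_trig_mx L ->
  top_rows V hm *m K = mxsub (widen_ord hm) (widen_ord hm) L *m top_rows V hm.
Proof.
move=> VK /is_trig_mxP Lt; apply/matrixP=> i j.
have := congr1 (fun M : 'M_(k, n) => M (widen_ord hm i) j) VK; rewrite !mxE.
move=> e; transitivity (\sum_l V (widen_ord hm i) l * K l j).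
  by apply: eq_bigr => l _; rewrite mxE.
(* In a row of index below [m], the entries of [L] in columns [l >= m] lie above the diagonal and
   vanish. *)
rewrite e (bigID (fun l : 'I_k => (l < m)%N)) /= [X in _ + X]big1 ?addr0; last first.
  by move=> l; rewrite -leqNgt => ml; rewrite Lt ?mul0r // (leq_trans (ltn_ord i)).
rewrite (big_ord_narrow hm); apply: eq_bigr => l _; by rewrite !mxE.
Qed.

Lemma take_map_enum (f : 'I_k -> F) m (hm : (m <= k)%N) :
  [seq f (widen_ord hm i) | i <- enum 'I_m] = take m [seq f i | i <- enum 'I_k].
Proof.
have sz : size (take m [seq f i | i <- enum 'I_k]) = m.
  by rewrite size_takel // size_map size_enum_ord.
apply: (@eq_from_nth _ 0); first by rewrite sz size_map size_enum_ord.
move=> j; rewrite size_map size_enum_ord => jm.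
rewrite nth_take // (nth_map (Ordinal jm)) ?size_enum_ord //.
rewrite (nth_map (Ordinal (leq_trans jm hm))) ?size_enum_ord ?(leq_trans jm) //.
congr f; apply: val_inj; rewrite /= !nth_enum_ord // (leq_trans jm) //.
Qed.

End Prefix.

Lemma rows_upto_diag (R : rcfType) n k (f : 'I_k -> 'cV[R]_n) (i : 'I_k) :
  rows_upto f i =
  diag_mx (\row_(j < k) (j <= i)%:R) *m (\matrix_(j < k) (f j)^T).
Proof.
apply/row_matrixP=> j; rewrite row_mul row_diag_mx -scalemxAl -rowE !rowK mxE.
by case: (j <= i)%N; rewrite ?scale1r ?scale0r.
Qed.

Lemma trig_coeff (R : rcfType) n k (f g : 'I_k -> 'cV[R]_n) :
  (forall i, (rows_upto f i <= rows_upto g i)%MS) ->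
  exists2 C : 'M[R]_k, is_trig_mx C &
    \matrix_(j < k) (f j)^T = C *m \matrix_(j < k) (g j)^T.
Proof.
move=> fg; pose dg i : 'M[R]_k := diag_mx (\row_(j < k) (j <= i)%:R).
(* Row [i] holds coordinates of [f i] in the masked family of [g]; the extra factor [dg i] clears
   the columns beyond [i], which makes [C] triangular. *)
pose C := \matrix_(i < k) ((f i)^T *m pinvmx (rows_upto g i) *m dg i).
exists C.
  apply/is_trig_mxP=> i j ij.
  by rewrite mxE mul_mx_diag !mxE leqNgt ij mulr0.
apply/row_matrixP=> i; rewrite row_mul !rowK -mulmxA -rows_upto_diag mulmxKpV //.
apply: submx_trans (fg i); have -> : (f i)^T = row i (rows_upto f i).
  by rewrite rowK leqnn.
exact: row_sub.
Qed.

End Flags.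

(** * Sorted lists of eigenvalues *)

Section Order.
Variable R : realDomainType.

(** This is selection sort: once the first [m] entries agree, the rests are permutations of each
    other, and the head of each rest is its maximum. *)
Lemma take_sorted_prefix (ms t : seq R) : sorted >=%R t ->
  (forall m, (m < size ms)%N -> exists2 s,
     perm_eq (take m.+1 ms ++ s) t & forall x, x \in s -> x <= nth 0 ms m) ->
  ms = take (size ms) t.
Proof.
move=> st H; suff key m : (m <= size ms)%N -> take m ms = take m t.
  by rewrite -key // take_size.
elim: m => [|m IH] hm; first by rewrite !take0.
have {H}[s sp sm] := H m hm; rewrite (take_nth 0) // IH ?(ltnW hm) // in sp *.
have mt : (m < size t)%N.
  have := perm_size sp; rewrite size_cat size_rcons size_take.
  by case: ltnP => // _; lia.
rewrite (take_nth 0 mt); congr rcons.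
move: sp; rewrite cat_rcons -[X in perm_eq _ X](cat_take_drop m t) perm_cat2l.
have := drop_sorted m st; rewrite (drop_nth 0 mt) /= => /order_path_min.
move=> /(_ (fun _ _ _ h h' => le_trans h' h))/allP tm sp.
apply/le_anti/andP; split.
  have : nth 0 ms m \in nth 0 t m :: drop m.+1 t.
    by rewrite -(perm_mem sp) mem_head.
  by rewrite inE => /orP[/eqP->//|/tm].
have : nth 0 t m \in nth 0 ms m :: s by rewrite (perm_mem sp) mem_head.
by rewrite inE => /orP[/eqP->//|/sm].
Qed.

Lemma mem_drop_enum n (lam : 'I_n -> R) m x :
  x \in drop m [seq lam i | i <- enum 'I_n] <->
  exists2 j : 'I_n, (m <= j)%N & x = lam j.
Proof.
split=> [/(nthP 0)[i]|[j mj ->]].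
  rewrite size_drop size_map size_enum_ord nth_drop => im <-.
  have imn : (m + i < n)%N by lia.
  exists (Ordinal imn); first by rewrite /= leq_addr.
  rewrite (nth_map (Ordinal imn)) ?size_enum_ord //; congr lam.
  by apply: val_inj; rewrite /= nth_enum_ord.
have -> : lam j = nth 0 (drop m [seq lam i | i <- enum 'I_n]) (j - m).
  rewrite nth_drop subnKC // (nth_map j) ?size_enum_ord //.
  by rewrite nth_ord_enum.
by rewrite mem_nth // size_drop size_map size_enum_ord ltn_sub2r ?(leq_ltn_trans mj).
Qed.

Lemma sorted_map_enum n (lam : 'I_n -> R) :
  (forall i j : 'I_n, (i < j)%N -> lam j <= lam i) ->
  sorted >=%R [seq lam i | i <- enum 'I_n].
Proof.
move=> hord; case: n lam hord => [|n] lam hord; first by rewrite enum_ord0.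
apply/(sortedP 0) => i; rewrite size_map size_enum_ord => hi.
rewrite !(nth_map ord0) -?enumT ?size_enum_ord ?(ltnW hi) //.
by apply: hord; rewrite -?enumT !nth_enum_ord ?(ltnW hi).
Qed.

End Order.

(** * The unstable subspace *)

Section Unstable.
Variable R : rcfType.

(** One factor of the shift already kills an eigenvector, and [0 < n] provides a factor in the
    [n]-th power. *)
Lemma unstable_eigen n p (A : 'M[R]_n) (a : 'I_p -> R) (u : 'I_p -> 'cV[R]_n) :
  (0 < n)%N -> (forall l, 0 < a l) -> (forall l, A *m u l = a l *: u l) ->
  unstable_subspace A (\sum_l u l).
Proof.
move=> n0 a0 uA; exists p, a, (fun _ => 0), (fun l => col_mx (u l) 0).
split=> // [l|]; last by apply: eq_bigr => l _; rewrite col_mxKu.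
case: n A n0 u uA => // n A _ u uA.
rewrite exprSr -mulmxA cplx_shift_mul uA subrr mulmx0 !scaler0 scale0r !subr0.
by rewrite addr0 col_mx0 mulmx0.
Qed.

(* A generalized eigenvector for an eigenvalue of positive real part vanishes in
   a quotient on which all eigenvalues have negative real part. *)
Lemma unstable_quotient n r (A : 'M[R]_n) (G : 'M_(n, r)) (D : 'M_r) u :
  A^T *m G = G *m D -> all_eig_neg_re D^T -> unstable_subspace A u ->
  u^T *m G = 0.
Proof.
move=> AG Dneg [p [a [b [z [a0 zA ->]]]]].
suff key : forall l, G^T *m usubmx (z l) = 0.
  apply: trmx_inj; rewrite trmx_mul trmxK trmx0 mulmx_sumr big1 //.
move=> l; have GA : G^T *m A = D^T *m G^T.
  by apply: trmx_inj; rewrite !trmx_mul !trmxK.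
(* [G^T] intertwines the shifts of [A] and [D^T]. The latter is injective for eigenvalue candidates
   with positive real part, so the factors of the power can be peeled off one at a time. *)
have inj q (y : 'cV_(n + n)) : cplx_shift A (a l) (b l) ^+ q *m y = 0 ->
    col_mx (G^T *m usubmx y) (G^T *m dsubmx y) = 0.
  elim: q y => [|q IH] y; first by rewrite expr0 mul1mx => ->; rewrite !linear0 col_mx0.
  rewrite exprSr -mulmxA => /IH.
  rewrite -{1 2}[y]vsubmxK cplx_shift_mul col_mxKu col_mxKd => e.
  apply: (all_eig_neg_inj Dneg (ltW (a0 l))); rewrite -{}e cplx_shift_mul.
  by rewrite !mulmxDr !mulmxN !mulmxA GA -!scalemxAr.
by have := inj _ _ (zA l); rewrite -col_mx0 => /eq_col_mx[].
Qed.

End Unstable.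

(** * Stability of the diagonal blocks *)

Section Linear.
Variables (R : rcfType) (n k : nat) (hk : (0 < k)%N) (hkn : (k <= n)%N).
Variables (J : 'M[R]_n) (lam : 'I_n -> R) (V : 'M[R]_(k, n)).
Hypothesis hchar : char_poly J = \prod_(i < n) ('X - (lam i)%:P).
Hypothesis hnz : forall i, lam i != 0.
Hypothesis hord : forall i j : 'I_n, (i < j)%N -> lam j <= lam i.
Hypothesis hstrict : forall i j : 'I_n, (i < j)%N -> (i < k)%N -> lam j < lam i.
Hypothesis VV : V *m V^T = 1%:M.

Let lamk (i : 'I_k) : R := lam (widen_ord hkn i).
Let t := [seq lam i | i <- enum 'I_n].

(** Indices start at 0: [ltn_ord i], read as [i.+1 <= k], selects the rows up to and including row
    [i]. For orthonormal rows this is an orthogonal projection. *)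
Definition flag_proj (i : 'I_k) : 'M[R]_n :=
  (top_rows V (ltn_ord i))^T *m top_rows V (ltn_ord i).

(* The linearizations, at a stationary point, of the equations for [x] and
   [v_i] with respect to [x] and [v_i]. *)
Definition position_block : 'M[R]_n := (1%:M - 2%:R *: (V^T *m V)) *m J.
Definition direction_block (c : R) (i : 'I_k) : 'M[R]_n :=
  J - flag_proj i *m (J + J^T) - c%:M.

Definition spectral_gap : Prop :=
  (forall j : 'I_n, (j < k)%N -> 0 < lam j) /\
  (forall j : 'I_n, (k <= j)%N -> lam j < 0).

Lemma char_poly_tr_spectrum : char_poly J^T = \prod_(c <- t) ('X - c%:P).
Proof. by rewrite char_poly_tr hchar big_map big_enum. Qed.

Lemma position_block_tr :
  position_block^T = J^T *m (1%:M - 2%:R *: (V^T *m V)).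
Proof.
by rewrite /position_block trmx_mul linearB /= linearZ /= trmx1 trmx_mul trmxK.
Qed.

(** Subspaces are row spaces here, so the blocks are transposed; [J^T^T] is left as is to match
    [invariant_split] with [K = J^T]. *)
Lemma direction_block_tr c i :
  (direction_block c i)^T = J^T - (J^T + J^T^T) *m flag_proj i - c%:M.
Proof.
rewrite /direction_block !linearB /= tr_scalar_mx !trmx_mul linearD /= !trmxK.
by rewrite addrC [J^T + J]addrC.
Qed.

Section Flag.
Variable L : 'M[R]_k.
Hypothesis VJ : V *m J^T = L *m V.
Hypothesis Lt : is_trig_mx L.

Lemma flag_split m (hm : (m <= k)%N) :
  exists r (N : 'M_(r, n)) (G : 'M_(n, r)) (D : 'M_r) (s : seq R),
  let V' := top_rows V hm in
  [/\ [/\ N *m V'^T = 0, V' *m G = 0, N *m G = 1%:M & V'^T *m V' + G *m N = 1%:M],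
      [/\ J^T *m G = G *m D, char_poly D = \prod_(c <- s) ('X - c%:P) &
       perm_eq (take m [seq L i i | i <- enum 'I_k] ++ s) t],
      char_poly (J^T *m (1%:M - 2%:R *: (V'^T *m V'))) =
        \prod_(c <- take m [seq - L i i | i <- enum 'I_k] ++ s) ('X - c%:P) &
      forall c, char_poly (J^T - (J^T + J^T^T) *m (V'^T *m V') - c%:M) =
        \prod_(x <- take m [seq - L i i - c | i <- enum 'I_k] ++ [seq x - c | x <- s])
           ('X - x%:P)].
Proof.
have [r [N [G [D [s [NG [KG Ds st] cA cB]]]]]] := invariant_spectrum
  (top_rows_ortho hm VV) (top_rows_invariant hm VJ Lt) (top_submx_trig hm Lt)
  char_poly_tr_spectrum.
have E (f : 'I_k -> R) := take_map_enum f hm.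
exists r, N, G, D, s; split=> //; first split=> //.
- by move: st; under eq_map do rewrite mxE; rewrite (E (fun i => L i i)).
- by rewrite cA; under eq_map do rewrite mxE; rewrite (E (fun i => - L i i)).
move=> c; rewrite cB; under eq_map do rewrite mxE.
by rewrite (E (fun i => - L i i - c)).
Qed.

(* All later eigenvalues lie strictly below [L i i], so [L] lists the spectrum in
   decreasing order. *)
Lemma stable_flag_diag :
  (forall i, all_eig_neg_re (direction_block (L i i) i)) ->
  forall i, L i i = lamk i.
Proof.
move=> neg; set ms := [seq L i i | i <- enum 'I_k].
have szm : size ms = k by rewrite size_map size_enum_ord.
have nthm (i : 'I_k) : nth 0 ms i = L i i.
  by rewrite (nth_map i) ?size_enum_ord ?nth_ord_enum.
have : ms = take (size ms) t.
  apply: take_sorted_prefix; first exact: sorted_map_enum.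
  rewrite szm => m hm; pose i := Ordinal hm.
  have [r [N [G [D [s [_ [_ _ st] _ cB]]]]]] := flag_split (ltn_ord i).
  (* For an eigenvalue [x] on the quotient, [x - L i i] is an eigenvalue of the direction block,
     hence negative. *)
  exists s => // x xs; rewrite (nthm i) -subr_le0 ltW //.
  move: (neg i); rewrite (all_eig_neg_split (s := _)); last first.
    by rewrite -char_poly_tr direction_block_tr; apply: cB.
  apply; rewrite mem_cat; apply/orP; right.
  exact: (map_f (fun y => y - L i i)) xs.
rewrite szm => mt i; rewrite -nthm mt nth_take // (nth_map (widen_ord hkn i)).
  rewrite /lamk; congr lam; apply: val_inj.
  by rewrite /= nth_enum_ord // (leq_trans _ hkn).
by rewrite size_enum_ord (leq_trans _ hkn).
Qed.

Hypothesis Ld : forall i, L i i = lamk i.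

Lemma take_diag m : (m <= k)%N -> take m [seq L i i | i <- enum 'I_k] = take m t.
Proof.
move=> hm; rewrite -(take_map_enum (fun i => L i i) hm).
rewrite -(take_map_enum lam (leq_trans hm hkn)); apply: eq_map => i.
by rewrite Ld; congr lam; apply: val_inj.
Qed.

Lemma quotient_spectrum m s : (m <= k)%N ->
  perm_eq (take m [seq L i i | i <- enum 'I_k] ++ s) t ->
  forall x, x \in s <-> exists2 j : 'I_n, (m <= j)%N & x = lam j.
Proof.
move=> hm; rewrite take_diag // -{2}(cat_take_drop m t) perm_cat2l => st x.
by rewrite (perm_mem st) mem_drop_enum.
Qed.

(** The eigenvalues of the block are [- lam j] for [j < k] and [lam j] for [j >= k]. *)
Lemma position_block_stable : all_eig_neg_re position_block <-> spectral_gap.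
Proof.
have [r [N [G [D [s [_ [_ _ st] cA _]]]]]] := flag_split (leqnn k).
have sP := quotient_spectrum (leqnn k) st.
have PV : top_rows V (leqnn k) = V.
  by apply/matrixP=> i j; rewrite mxE; congr (V _ _); apply: val_inj.
rewrite {}PV in cA.
rewrite (all_eig_neg_split (s := _)); last first.
  by rewrite -char_poly_tr position_block_tr; apply: cA.
rewrite take_oversize; last by rewrite size_map size_enum_ord.
split=> [neg|[pos neg] c].
  split=> j jk; last by apply: neg; rewrite mem_cat (sP _).2 ?orbT //; exists j.
  rewrite -oppr_lt0; have -> : lam j = L (Ordinal jk) (Ordinal jk).
    by rewrite Ld; congr lam; apply: val_inj.
  apply: neg; rewrite mem_cat; apply/orP; left.
  by apply: (map_f (fun i => - L i i)); rewrite mem_enum.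
rewrite mem_cat => /orP[/mapP[i _ ->]|/sP[j jk ->]]; last exact: neg.
by rewrite oppr_lt0 Ld pos /=.
Qed.

(** The eigenvalues are [- lam j - lam i] for [j <= i], negative by positivity, and [lam j - lam i]
    for [j > i], negative by the strict ordering. *)
Lemma direction_block_stable : spectral_gap ->
  forall i, all_eig_neg_re (direction_block (L i i) i).
Proof.
move=> [pos neg] i.
have [r [N [G [D [s [_ [_ _ st] _ cB]]]]]] := flag_split (ltn_ord i).
have sP := quotient_spectrum (ltn_ord i) st.
rewrite (all_eig_neg_split (s := _)); last first.
  by rewrite -char_poly_tr direction_block_tr; apply: cB.
have Lpos j : 0 < L j j by rewrite Ld pos /=.
move=> c; rewrite mem_cat => /orP[/mem_take/mapP[j _ ->]|/mapP[x /sP[j ij ->] ->]].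
  by rewrite -opprD oppr_lt0 addr_gt0.
by rewrite subr_lt0 Ld hstrict /=.
Qed.

(** An unstable vector vanishes in the quotient by the flag; the resolution of the identity [E1]
    then recovers it from its flag component alone. *)
Lemma quotient_neg m (hm : (m <= k)%N) :
  (forall j : 'I_n, (m <= j)%N -> lam j < 0) ->
  forall u, unstable_subspace J u -> (u^T <= top_rows V hm)%MS.
Proof.
move=> neg u uJ.
have [r [N [G [D [s [[_ _ _ E1] [JG Ds st] _ _]]]]]] := flag_split hm.
have sP := quotient_spectrum hm st.
have Dneg : all_eig_neg_re D^T.
  rewrite (all_eig_neg_split (s := s)) ?char_poly_tr //.
  by move=> c /sP[j mj ->]; apply: neg.
have uG := unstable_quotient JG Dneg uJ.
by rewrite -[u^T]mulmx1 -E1 mulmxDr !mulmxA uG mul0mx addr0 submxMl.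
Qed.

(** * Comparison of the flag with the leading eigenvectors *)

Section Eigenvectors.
Variable w : 'I_k -> 'cV[R]_n.
Hypothesis hw : forall j, w j != 0 /\ J *m w j = lamk j *: w j.
Let W : 'M[R]_(k, n) := \matrix_(i < k) (w i)^T.

Lemma eigen_row i : row i W != 0 /\ row i W *m J^T = lamk i *: row i W.
Proof.
by rewrite rowK trmx_eq0 -trmx_mul; case: (hw i) => -> ->; rewrite linearZ.
Qed.

Lemma lamk_inj : injective lamk.
Proof.
move=> i j e; apply/eqP/negPn/negP=> ne.
have : (i < j)%N || (j < i)%N by rewrite -neq_ltn.
case/orP=> ij.
  have := @hstrict (widen_ord hkn i) (widen_ord hkn j) ij (ltn_ord i).
  by rewrite -/(lamk i) -/(lamk j) e ltxx.
have := @hstrict (widen_ord hkn j) (widen_ord hkn i) ij (ltn_ord j).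
by rewrite -/(lamk i) -/(lamk j) e ltxx.
Qed.

Lemma eigen_row_free : row_free W.
Proof. exact: row_free_eigen lamk_inj eigen_row. Qed.

(** Otherwise the image of [w i] in the quotient would be an eigenvector for [lamk i], whereas the
    eigenvalues there are the [lam j] with [j > i], all strictly smaller. *)
Lemma eigen_in_flag i : (row i W <= top_rows V (ltn_ord i))%MS.
Proof.
have [r [N [G [D [s [[_ _ _ E1] [JG Ds st] _ _]]]]]] := flag_split (ltn_ord i).
have sP := quotient_spectrum (ltn_ord i) st.
suff wG : row i W *m G = 0.
  by rewrite -[row i W]mulmx1 -E1 mulmxDr !mulmxA wG mul0mx addr0 submxMl.
apply/eqP/negPn/negP=> wG0.
have : lamk i \in s.
  rewrite -root_prod_XsubC -Ds -eigenvalue_root_char.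
  apply/eigenvalueP; exists (row i W *m G) => //.
  by rewrite -mulmxA -JG mulmxA (eigen_row i).2 scalemxAl.
move=> /sP[j ij e]; have := @hstrict (widen_ord hkn i) j ij (ltn_ord i).
by rewrite -e ltxx.
Qed.

Lemma eigen_sub_flag : (W <= V)%MS.
Proof.
apply/row_subP=> i; apply: submx_trans (eigen_in_flag i) _.
by apply/row_subP=> j; rewrite row_rowsub row_sub.
Qed.

Lemma flag_eq_eigen : (V == W)%MS.
Proof.
rewrite andbC -(mxrank_leqif_eq eigen_sub_flag).2.
by rewrite (eqP eigen_row_free) (eqP (_ : row_free V)) //; apply/row_freeP; exists V^T.
Qed.

Lemma gap_has_dim : spectral_gap -> has_dim (unstable_subspace J) k.
Proof.
move=> [pos neg]; exists W; split=> [|u]; first exact: eigen_row_free.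
split=> [uJ|[c ->]].
  have : (u^T <= W)%MS.
    apply: submx_trans (quotient_neg (leqnn k) neg uJ) _.
    apply/row_subP=> j; rewrite row_rowsub (submx_trans (row_sub _ _)) //.
    by case/andP: flag_eq_eigen.
  by case/submxP=> c e; exists c; rewrite -e trmxK.
have -> : (c *m W)^T = \sum_j c 0 j *: w j.
  rewrite mulmx_sum_row linear_sum; apply: eq_bigr => j _.
  by rewrite linearZ /= rowK trmxK.
apply: (unstable_eigen (a := lamk)) => [|l|l].
- exact: leq_trans hkn.
- by rewrite pos /=.
by rewrite -scalemxAr (hw l).2 !scalerA mulrC.
Qed.

Lemma has_dim_gap : has_dim (unstable_subspace J) k -> spectral_gap.
Proof.
move=> [B [Bf BP]]; have n0 : (0 < n)%N by apply: leq_trans hkn.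
have UB u : unstable_subspace J u <-> (u^T <= B)%MS.
  rewrite BP; split=> [[c ->]|/submxP[c e]]; first by rewrite trmxK submxMl.
  by exists c; rewrite -e trmxK.
have rB : \rank B = k := eqP Bf.
have pos (j : 'I_n) : (j < k)%N -> 0 < lam j.
  move=> jk; rewrite lt0r hnz /= leNgt; apply/negP=> lj.
  (* If [lam j < 0] for some [j < k], every eigenvalue from index [k - 1] on is negative, so the
     unstable subspace lies in the span of [k - 1] rows, too few for its dimension. *)
  have hk1 : (k.-1 <= k)%N by rewrite leq_pred.
  have neg (l : 'I_n) : (k.-1 <= l)%N -> lam l < 0.
    move=> kl; apply: le_lt_trans lj; have : (j <= l)%N by lia.
    by rewrite leq_eqVlt => /orP[/eqP/val_inj->|/hord].
  have : (B <= top_rows V hk1)%MS.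
    apply/row_subP=> l; rewrite -[row l B]trmxK.
    by apply: quotient_neg => //; apply/UB; rewrite trmxK row_sub.
  move=> /mxrankS; rewrite rB => /leq_trans/(_ (rank_leq_row _)); lia.
split=> // j kj; rewrite lt_neqAle hnz /= leNgt; apply/negP=> lj.
have /eigenvalueP[y yJ y0] : eigenvalue J^T (lam j).
  rewrite eigenvalue_root_char char_poly_tr_spectrum root_prod_XsubC.
  by rewrite map_f ?mem_enum.
have in_B (a : R) (u : 'rV_n) : 0 < a -> u *m J^T = a *: u -> (u <= B)%MS.
  move=> a0 ua; rewrite -[u]trmxK; apply/UB.
  have Ju : J *m u^T = a *: u^T by rewrite -[J]trmxK -trmx_mul ua linearZ.
  have -> : u^T = \sum_(l < 1) u^T by rewrite big_ord1.
  exact: (unstable_eigen (a := fun _ => a)).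
(* The [w i] are unstable, and ranks agree, so [B] and [W] span the same space; the eigenvector [y]
   of a positive [lam j] with [j >= k] must therefore lie in it. *)
have WB : (W <= B)%MS.
  apply/row_subP=> i; apply: (in_B (lamk i)) (eigen_row i).2.
  by apply: pos => /=.
have BW : (B <= W)%MS.
  have := (mxrank_leqif_eq WB).2; rewrite (eqP eigen_row_free) rB eqxx.
  by move=> /esym/andP[].
have /submxP[c yc] := submx_trans (in_B _ _ lj yJ) BW.
(* A nonzero coordinate of [y] on [w i] forces [lamk i = lam j], against the strict gap after index
   [k - 1]. *)
have cl : c *m diag_mx (\row_i lamk i) = lam j *: c.
  apply: (row_free_inj eigen_row_free); rewrite -scalemxAl -yc -yJ yc -!mulmxA.
  congr (_ *m _); apply/row_matrixP=> i.
  rewrite !row_mul row_diag_mx -scalemxAl -rowE mxE.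
  by rewrite (eigen_row i).2.
case/eqP: y0; rewrite yc [c](_ : _ = 0) ?mul0mx //; apply/rowP=> i.
have := congr1 (fun M : 'rV_k => M 0 i) cl; rewrite mul_mx_diag !mxE.
move=> /eqP; rewrite mulrC -subr_eq0 -mulrBl mulf_eq0 => /orP[|/eqP//].
rewrite subr_eq0 => /eqP e.
have := @hstrict (widen_ord hkn i) j (leq_trans (ltn_ord i) kj) (ltn_ord i).
by rewrite -/(lamk i) e ltxx.
Qed.

(** One inclusion is [eigen_in_flag]. Equality follows by rank, both masked families being the same
    diagonal matrix times a row-free one. *)
Lemma flag_spans (v : 'I_k -> 'cV[R]_n) :
  V = \matrix_(i < k) (v i)^T ->
  forall i, (rows_upto v i == rows_upto w i)%MS.
Proof.
move=> Vv i; have Vf : row_free V by apply/row_freeP; exists V^T.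
have sub : (rows_upto w i <= rows_upto v i)%MS.
  apply/row_subP=> j; rewrite rowK; case: ifP => ji; last exact: sub0mx.
  have := eigen_in_flag j; rewrite rowK => /submx_trans; apply.
  apply/row_subP=> l; rewrite row_rowsub Vv rowK.
  have -> : (v (widen_ord (ltn_ord j) l))^T =
            row (widen_ord (ltn_ord j) l) (rows_upto v i).
    by rewrite rowK /= (leq_trans _ ji) // -ltnS ltn_ord.
  exact: row_sub.
rewrite andbC -(mxrank_leqif_eq sub).2 !rows_upto_diag -Vv -/W.
by rewrite !mxrankMfree ?eigen_row_free.
Qed.

End Eigenvectors.
End Flag.

(** Equal spans give triangular [C'] and [C] with [V = C' W] and [W = C V], so [L = C' La C]. As
    [C' C = 1], conjugation preserves the diagonal of [La]. *)
Lemma spans_flag (w v : 'I_k -> 'cV[R]_n) :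
  (forall j, w j != 0 /\ J *m w j = lamk j *: w j) ->
  V = \matrix_(i < k) (v i)^T ->
  (forall i, (rows_upto v i == rows_upto w i)%MS) ->
  exists2 L : 'M[R]_k, V *m J^T = L *m V &
    is_trig_mx L /\ forall i, L i i = lamk i.
Proof.
move=> hw Vv vw.
have [i|C' C't] := @trig_coeff R n k v w; first by case/andP: (vw i).
have [i|C Ct] := @trig_coeff R n k w v; first by case/andP: (vw i).
rewrite -Vv; set W := \matrix_(i < k) (w i)^T => WC VC'.
pose La := diag_mx (\row_i lamk i).
have WJ : W *m J^T = La *m W.
  apply/row_matrixP=> i; rewrite !row_mul row_diag_mx -scalemxAl -rowE mxE.
  by rewrite (eigen_row hw i).2.
have CC : C' *m C = 1%:M.
  by rewrite -[C' *m C]mulmx1 -VV !mulmxA -[C' *m C *m V]mulmxA -WC -VC' VV.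
have Lat : is_trig_mx La by exact: diag_mx_is_trig.
have [t1 d1] := trig_mulmx C't Lat; have [t2 d2] := trig_mulmx t1 Ct.
have [_ d3] := trig_mulmx C't Ct.
exists (C' *m La *m C); first by rewrite {1}VC' -mulmxA WJ WC !mulmxA.
split=> // i; rewrite d2 d1 mulrAC -d3 CC !mxE !eqxx mul1r //.
Qed.

Lemma eigenvalues_nonzero_hyperbolic : hyperbolic_mx J.
Proof.
apply: (hyperbolic_split (s := t)); first by rewrite -char_poly_tr char_poly_tr_spectrum.
by move=> c /mapP[i _ ->].
Qed.

End Linear.

(** * Block triangular operators *)

Section BlockTriangular.
Variable F : fieldType.

Lemma mulmx_inj_unit n (M : 'M[F]_n) :
  (forall z : 'cV_n, M *m z = 0 -> z = 0) -> M \in unitmx.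
Proof.
move=> inj; rewrite -unitmx_tr -row_free_unit -kermx_eq0.
apply/eqP/row_matrixP=> l; rewrite row0; apply: trmx_inj; rewrite trmx0.
apply: inj; apply: trmx_inj; rewrite trmx_mul trmxK -row_mul mulmx_ker.
by rewrite row0 trmx0.
Qed.

(** [M] is described through jointly bijective coordinates [c i]. By [cM] it is block triangular for
    the order given by [lev], with diagonal blocks [B i]. *)
Variables (N q : nat) (I : eqType) (lev : I -> nat).
Variables (c : I -> 'cV[F]_N -> 'cV[F]_q) (M : 'M[F]_N) (B : I -> 'M[F]_q).
Hypothesis c0 : forall i, c i (0 : 'cV_N) = 0.
Hypothesis c_inj : forall z, (forall i, c i z = 0) -> z = 0.
Hypothesis c_surj : forall y, exists z, forall i, c i z = y i.
Hypothesis cM : forall i z, (forall j, (lev j < lev i)%N -> c j z = 0) ->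
  c i (M *m z) = B i *m c i z.

(** Forward substitution: the coordinates of a kernel vector vanish level by level. *)
Lemma block_trig_inj :
  (forall i (y : 'cV_q), B i *m y = 0 -> y = 0) ->
  forall z : 'cV_N, M *m z = 0 -> z = 0.
Proof.
move=> Binj z Mz; apply: c_inj => i.
have [m] := ubnP (lev i); elim: m i => // m IH i im.
apply: (Binj i); rewrite -cM ?Mz ?c0 // => j ji.
by apply: IH; apply: leq_trans ji _.
Qed.

(* Injectivity does not pass to the diagonal blocks, but surjectivity does. *)
Lemma block_trig_inj_diag :
  (forall z : 'cV_N, M *m z = 0 -> z = 0) ->
  forall i (y : 'cV_q), B i *m y = 0 -> y = 0.
Proof.
move=> /mulmx_inj_unit uM i.
have [m] := ubnP (lev i); elim: m i => // m IH i im.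
(* The preimage under [M] of the vector with [y] at position [i] and 0 elsewhere has no coordinate
   of lower level, since the lower diagonal blocks are injective by induction. Its [i]-th coordinate
   thus solves the equation. *)
have surj (y : 'cV_q) : exists x, B i *m x = y.
  have [z' z'P] := c_surj (fun j => if j == i then y else 0).
  pose z := invmx M *m z'; have Mz : M *m z = z' by rewrite mulKVmx.
  have cz j : (lev j < lev i)%N -> c j z = 0.
    have [p] := ubnP (lev j); elim: p j => // p IHp j jp ji.
    apply: (IH j); first exact: leq_trans ji _.
    rewrite -cM ?Mz ?z'P => [|l lj].
      by case: eqP ji => // ->; rewrite ltnn.
    by apply: IHp; [exact: leq_trans lj _|exact: ltn_trans ji].
  by exists (c i z); rewrite -cM // Mz z'P eqxx.
suff uB : B i \in unitmx.
  by move=> y By; rewrite -[y](mulKmx uB) By mulmx0.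
rewrite -row_free_unit -kermx_eq0; apply/eqP/matrixP=> l j.
have [x xB] := surj (delta_mx j 0).
have := congr1 (mulmx (kermx (B i))) xB.
rewrite mulmxA mulmx_ker mul0mx -colE => /colP/(_ l).
by rewrite !mxE.
Qed.

End BlockTriangular.

(** * Coordinates of a state and the spectrum of a triangular linearization *)

Section GHiSDState.
Variables (R : rcfType) (n k : nat).
Implicit Types (s h : 'cV[R]_(n + k * n)).

Lemma ghisd_v_state x (v : 'I_k -> 'cV[R]_n) i : ghisd_v (ghisd_state x v) i = v i.
Proof.
by rewrite /ghisd_v /ghisd_state col_mxKd trmxK mxvecK rowK trmxK.
Qed.

Lemma usubmx_state x (v : 'I_k -> 'cV[R]_n) : usubmx (ghisd_state x v) = x.
Proof. by rewrite /ghisd_state col_mxKu. Qed.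

Lemma ghisd_state_eta s : s = ghisd_state (usubmx s) (ghisd_v s).
Proof.
rewrite -[LHS]vsubmxK /ghisd_state; congr col_mx.
apply: trmx_inj; rewrite trmxK; apply: (can_inj vec_mxK); rewrite mxvecK.
by apply/row_matrixP=> i; rewrite rowK trmxK.
Qed.

Lemma ghisd_v_linear i : linear (fun s => ghisd_v s i).
Proof. by move=> a u v; rewrite /ghisd_v !linearP. Qed.

Lemma ghisd_v0 i : ghisd_v (0 : 'cV[R]_(n + k * n)) i = 0.
Proof. by rewrite /ghisd_v !linear0. Qed.

Lemma ghisd_stateP s s' : usubmx s = usubmx s' ->
  (forall i, ghisd_v s i = ghisd_v s' i) -> s = s'.
Proof.
move=> e1 e2; rewrite [s]ghisd_state_eta [s']ghisd_state_eta e1 /ghisd_state.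
by congr (col_mx _ (mxvec _)^T); apply/row_matrixP=> i; rewrite !rowK e2.
Qed.

(** Real and imaginary parts are regrouped per unknown, with [None] standing for the position, so
    that a complex shift of the whole operator acts by complex shifts of its blocks. *)
Definition pair_coord (i : option 'I_k)
    (z : 'cV[R]_((n + k * n) + (n + k * n))) : 'cV[R]_(n + n) :=
  if i is Some j then col_mx (ghisd_v (usubmx z) j) (ghisd_v (dsubmx z) j)
  else col_mx (usubmx (usubmx z)) (usubmx (dsubmx z)).

Variables (D : 'M[R]_(n + k * n)) (A : 'M[R]_n) (B : 'I_k -> 'M[R]_n).
Hypothesis DA : forall h, usubmx (D *m h) = A *m usubmx h.
Hypothesis DB : forall (i : 'I_k) h, usubmx h = 0 ->
  (forall j : 'I_k, (j < i)%N -> ghisd_v h j = 0) ->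
  ghisd_v (D *m h) i = B i *m ghisd_v h i.

Lemma all_eig_neg_injP m (M : 'M[R]_m) :
  (forall a b (z : 'cV_(m + m)), 0 <= a -> cplx_shift M a b *m z = 0 -> z = 0) <->
  all_eig_neg_re M.
Proof.
split=> [inj a b [z z0 Mz]|neg a b z]; last exact: all_eig_neg_inj.
by rewrite ltNge; apply: contraNN z0 => a0; rewrite (inj a b z).
Qed.

(** Stability means injectivity of all shifts with [a >= 0], and for each such shift injectivity can
    be tested on the diagonal blocks, in the order position, first direction, second direction, and
    so on. *)
Lemma ghisd_all_eig_neg :
  all_eig_neg_re D <-> all_eig_neg_re A /\ forall i, all_eig_neg_re (B i).
Proof.
pose lev (i : option 'I_k) := if i is Some j then j.+1 else 0%N.
pose Bl a b (i : option 'I_k) := cplx_shift (if i is Some j then B j else A) a b.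
have c0 i : pair_coord i 0 = 0.
  by case: i => [i|]; rewrite /pair_coord !linear0 ?ghisd_v0 ?linear0 col_mx0.
have c_inj z : (forall i, pair_coord i z = 0) -> z = 0.
  move=> z0; have [u0 d0] : usubmx (usubmx z) = 0 /\ usubmx (dsubmx z) = 0.
    by have := z0 None; rewrite /= -col_mx0 => /eq_col_mx.
  have v0 i : ghisd_v (usubmx z) i = 0 /\ ghisd_v (dsubmx z) i = 0.
    by have := z0 (Some i); rewrite /= -col_mx0 => /eq_col_mx.
  rewrite -[z]vsubmxK -[RHS]col_mx0; congr col_mx; apply: ghisd_stateP => [|i];
    rewrite ?linear0 ?ghisd_v0 //; by case: (v0 i).
have c_surj y : exists z, forall i, pair_coord i z = y i.
  exists (col_mx (ghisd_state (usubmx (y None)) (fun i => usubmx (y (Some i))))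
                 (ghisd_state (dsubmx (y None)) (fun i => dsubmx (y (Some i))))).
  by move=> [i|]; rewrite /= col_mxKu col_mxKd ?ghisd_v_state ?usubmx_state vsubmxK.
have cM a b i z : (forall j, (lev j < lev i)%N -> pair_coord j z = 0) ->
    pair_coord i (cplx_shift D a b *m z) = Bl a b i *m pair_coord i z.
  rewrite -[z in cplx_shift _ _ _ *m z]vsubmxK cplx_shift_mul /Bl.
  case: i => [i|] zj /=; rewrite col_mxKu col_mxKd cplx_shift_mul; last first.
    by rewrite !linearD !linearN /= !linearZ /= !DA.
  have [u0 d0] : usubmx (usubmx z) = 0 /\ usubmx (dsubmx z) = 0.
    by have := zj None isT; rewrite /= -col_mx0 => /eq_col_mx.
  have v0 (j : 'I_k) : (j < i)%N ->
      ghisd_v (usubmx z) j = 0 /\ ghisd_v (dsubmx z) j = 0.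
    by move=> ji; have := zj (Some j) ji; rewrite /= -col_mx0 => /eq_col_mx.
  have lin3 (x y y' : 'cV[R]_(n + k * n)) e f : ghisd_v (x + e *: y + f *: y') i =
      ghisd_v x i + e *: ghisd_v y i + f *: ghisd_v y' i.
    by rewrite /ghisd_v !(linearD, linearZ).
  rewrite -!scaleNr !lin3 !DB // => [j /v0[]|j /v0[]] //.
rewrite -!all_eig_neg_injP; split=> [inj|[injA injB] a b z a0].
  have key a b := block_trig_inj_diag c_surj (cM a b).
  split=> [a b z a0|i]; first by move: z; apply: (key a b _ None) => z; apply: inj.
  rewrite -all_eig_neg_injP => a b z a0.
  by move: z; apply: (key a b _ (Some i)) => z; apply: inj.
apply: (block_trig_inj c0 c_inj (cM a b)) => -[i|] y; first exact: all_eig_neg_inj.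
exact: injA.
Qed.

End GHiSDState.

(** * Linearization of the GHiSD system *)

Section Stationary.
Variables (R : rcfType) (n k : nat).
Variables (F : 'cV[R]_n -> 'cV[R]_n) (J : 'cV[R]_n -> 'M[R]_n).
Variables (xs : 'cV[R]_n) (vs : 'I_k -> 'cV[R]_n).
Let V : 'M[R]_(k, n) := \matrix_(i < k) (vs i)^T.
Let J0 := J xs.
Let Q : 'M[R]_k := V *m J0^T *m V^T.
Let s0 := ghisd_state xs vs.

Lemma sum_outer : \sum_j vs j *m (vs j)^T = V^T *m V.
Proof.
apply/matrixP=> a b; rewrite summxE mxE; apply: eq_bigr => j _.
by rewrite !mxE big_ord1 !mxE.
Qed.

Lemma sum_outer_le (i : 'I_k) :
  \sum_(j < k | (j <= i)%N) vs j *m (vs j)^T = flag_proj V i.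
Proof.
apply/matrixP=> a b; rewrite summxE mxE (big_ord_narrow (ltn_ord i)).
by apply: eq_bigr => j _; rewrite !mxE big_ord1 !mxE.
Qed.

Lemma sum_outer_split (i : 'I_k) (f : 'I_k -> 'M[R]_n) :
  \sum_(j < k | (j <= i)%N) f j = f i + \sum_(j < k | (j < i)%N) f j.
Proof.
rewrite (bigD1 i) //=; congr (_ + _); apply: eq_bigl => j.
by rewrite ltn_neqAle andbC val_eqE.
Qed.

Lemma flag_coeffE i j : (vs j)^T *m J0 *m vs i = (Q i j)%:M.
Proof.
have -> : (vs j)^T *m J0 *m vs i = (row i V *m J0^T *m (row j V)^T)^T.
  by rewrite !rowK !trmx_mul !trmxK mulmxA.
rewrite [LHS]mx11_scalar; congr _%:M; rewrite mxE -row_mul mxE [RHS]mxE.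
by apply: eq_bigr => l _; rewrite !mxE.
Qed.

Lemma flag_coeff_trE i j : (vs j)^T *m J0^T *m vs i = (Q j i)%:M.
Proof. by apply: trmx_inj; rewrite !trmx_mul !trmxK mulmxA flag_coeffE tr_scalar_mx. Qed.

(** Row [i] lists the coefficients on the [vs j] of what the [i]-th direction equation subtracts
    from [J0 *m vs i]. *)
Definition stationary_coeff : 'M[R]_k :=
  \matrix_(i, j) if (j < i)%N then Q i j + Q j i else if j == i then Q i i else 0.

Lemma direction_rows :
  \matrix_(i < k) ((1%:M - vs i *m (vs i)^T) *m J0 *m vs i
     - \sum_(j < k | (j < i)%N) vs j *m (vs j)^T *m (J0 + J0^T) *m vs i)^T =
  V *m J0^T - stationary_coeff *m V.
Proof.
apply/row_matrixP=> i; rewrite rowK [RHS]linearB /= !row_mul rowK.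
apply: trmx_inj; rewrite trmxK linearB /= trmx_mul !trmxK.
rewrite !mulmxBl mul1mx -addrA; congr (_ + _); rewrite -opprD; congr (- _).
rewrite mulmx_sum_row linear_sum /=.
rewrite [RHS](bigID (fun j : 'I_k => (j < i)%N)) /= [RHS]addrC.
rewrite [X in _ = X + _](bigD1 i) /= ?ltnn //.
rewrite [X in _ = _ + X + _]big1 ?addr0 => [|j]; last first.
  by rewrite -leqNgt => /andP[ij ji]; rewrite !mxE ltnNge ij (negPf ji) scale0r linear0.
congr (_ + _).
  rewrite -!mulmxA [_^T *m _]mulmxA flag_coeffE mul_mx_scalar linearZ /= rowK trmxK.
  by rewrite !mxE ltnn eqxx.
apply: eq_bigr => j ji; rewrite -!mulmxA [_^T *m _]mulmxA mulmxDr mulmxDl.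
rewrite flag_coeffE flag_coeff_trE -raddfD mul_mx_scalar linearZ /= rowK trmxK.
by rewrite !mxE ji.
Qed.

Hypothesis VV : V *m V^T = 1%:M.

(** The reflection [1 - 2 P] is an involution, so the position equation forces [F xs = 0].
    Conversely to the triangular form of [stationary_coeff], any [L] must equal [Q], and its
    triangularity kills the entries [Q j i] with [j < i], so that [Q] is [stationary_coeff]. *)
Lemma stationary_iff : ghisd_field F J s0 = 0 <->
  F xs = 0 /\ exists2 L : 'M[R]_k, V *m J0^T = L *m V & is_trig_mx L.
Proof.
pose P := V^T *m V; have PP : P *m P = P.
  by rewrite /P mulmxA -[_ *m V *m _]mulmxA VV mulmx1.
have refl : (1%:M - 2%:R *: P) *m (1%:M - 2%:R *: P) = 1%:M.
  rewrite mulmxBr mulmx1 mulmxBl mul1mx -scalemxAr -scalemxAl PP.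
  by clear; move: P => P; apply/matrixP=> i j; rewrite !mxE; ring.
rewrite /ghisd_field usubmx_state; under eq_bigr do rewrite ghisd_v_state.
have -> : \matrix_(i < k)
    ((1%:M - ghisd_v s0 i *m (ghisd_v s0 i)^T) *m J xs *m ghisd_v s0 i
     - \sum_(j < k | (j < i)%N) ghisd_v s0 j *m (ghisd_v s0 j)^T *m (J xs + (J xs)^T)
         *m ghisd_v s0 i)^T = V *m J0^T - stationary_coeff *m V.
  rewrite -direction_rows; apply/row_matrixP=> i; rewrite !rowK ghisd_v_state.
  by under eq_bigr do rewrite ghisd_v_state.
rewrite sum_outer -/P -[X in _ = X]col_mx0; split=> [/eq_col_mx[e1 e2]|[-> [L VL Lt]]].
  split.
    by rewrite -[F xs]mul1mx -refl -mulmxA e1 mulmx0.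
  exists stationary_coeff.
    apply/eqP; rewrite -subr_eq0; apply/eqP/(can_inj mxvecK).
    by apply: trmx_inj; rewrite e2 !linear0.
  apply/is_trig_mxP=> i j ij; rewrite [LHS]mxE ltnNge (ltnW ij) /=.
  by rewrite -val_eqE (gtn_eqF ij).
have LQ : L = Q by rewrite /Q VL -mulmxA VV mulmx1.
rewrite mulmx0 (_ : V *m J0^T - _ = 0) ?linear0 //.
apply/eqP; rewrite subr_eq0 VL; apply/eqP; congr (_ *m _).
move/is_trig_mxP: Lt; rewrite LQ => Qt.
apply/matrixP=> i j; rewrite [RHS]mxE; case: (ltngtP j i) => [ji|ij|/val_inj->].
- by rewrite (Qt j i ji) addr0.
- by rewrite -val_eqE (gtn_eqF ij) Qt.
by rewrite eqxx.
Qed.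

Hypothesis dF : is_deriv F xs J0.
Variable dJ : 'cV[R]_n -> 'M[R]_n.
Hypothesis dJP : mx_deriv J xs dJ.
Hypothesis Fx0 : F xs = 0.

Lemma ghisd_deriv : exists D : 'M[R]_(n + k * n),
  [/\ is_deriv (ghisd_field F J) s0 D,
      forall h : 'cV[R]_(n + k * n), usubmx (D *m h) = position_block J0 V *m usubmx h &
      forall (i : 'I_k) (h : 'cV[R]_(n + k * n)), usubmx h = 0 ->
        (forall j : 'I_k, (j < i)%N -> ghisd_v h j = 0) ->
        ghisd_v (D *m h) i = direction_block J0 V (Q i i) i *m ghisd_v h i].
Proof.
have dX : mx_deriv (fun s => F (usubmx s)) s0 (fun h => J0 *m usubmx h).
  by apply: mx_deriv_comp_usub; rewrite usubmx_state; apply: is_deriv_mx_deriv.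
have dJX : mx_deriv (fun s => J (usubmx s)) s0 (fun h => dJ (usubmx h)).
  by apply: mx_deriv_comp_usub; rewrite usubmx_state.
have dv i : mx_deriv (fun s => ghisd_v s i) s0 (fun h => ghisd_v h i).
  exact/mx_deriv_linear/ghisd_v_linear.
have dvv i := mx_derivM (dv i) (mx_deriv_tr (dv i)).
have d1 := mx_deriv_cst (1%:M : 'M[R]_n) s0.
have dx := mx_derivM (mx_derivB d1
  (mx_derivZ 2%:R (mx_deriv_sum (index_enum 'I_k) (P := predT) (fun i _ => dvv i)))) dX.
have dvi i := mx_derivB
  (mx_derivM (mx_derivM (mx_derivB d1 (dvv i)) dJX) (dv i))
  (mx_deriv_sum (index_enum 'I_k) (P := fun j : 'I_k => (j < i)%N)
     (fun j _ => mx_derivM (mx_derivM (dvv j) (mx_derivD dJX (mx_deriv_tr dJX))) (dv i))).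
have := mx_deriv_is_deriv (mx_deriv_col dx (mx_deriv_tr_vec (mx_deriv_rows dvi))).
move=> [D dD DE]; exists D; split; first exact: dD.
  (* The derivative of the reflection is multiplied by [F xs = 0], so the directions do not affect
     the position equation to first order. *)
  move=> h; rewrite -DE col_mxKu usubmx_state Fx0 mulmx0 add0r mulmxA.
  under eq_bigr do rewrite ghisd_v_state.
  by rewrite sum_outer.
move=> i h hx hj; rewrite -DE.
have gv x (M : 'M[R]_(k, n)) : ghisd_v (col_mx x (mxvec M)^T) i = (row i M)^T.
  by rewrite /ghisd_v col_mxKd trmxK mxvecK.
have dJ0 : dJ 0 = 0.
  by have := dJP.1 (-1) 0 0; rewrite scaler0 addr0 scaleN1r addNr.
rewrite gv rowK trmxK hx dJ0 mulmx0 addr0 usubmx_state -/J0 trmx0 addr0.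
rewrite ghisd_v_state; set hv := ghisd_v h i.
(* Earlier directions are unperturbed, so only the last factor of each summand varies. *)
rewrite (eq_bigr (fun j => vs j *m (vs j)^T *m (J0 + J0^T) *m hv)); last first.
  move=> j ji; rewrite hj // ghisd_v_state trmx0 mul0mx !mulmx0 !addr0.
  by rewrite !mul0mx add0r.
have e1 : hv *m (vs i)^T *m J0 *m vs i = (Q i i)%:M *m hv.
  by rewrite -!(mulmxA hv) flag_coeffE mul_mx_scalar mul_scalar_mx.
(* The scalar [hv^T J0 vs i] equals its transpose; this term supplies the [J0^T] part of the [j = i]
   summand, completing the sum over [j < i] to the flag projection. *)
have e2 : vs i *m hv^T *m J0 *m vs i = vs i *m (vs i)^T *m J0^T *m hv.
  rewrite -!mulmxA; congr (_ *m _).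
  have sym (a : 'M[R]_1) : a^T = a by rewrite [a]mx11_scalar tr_scalar_mx.
  by rewrite -[LHS]sym !trmx_mul !trmxK mulmxA.
rewrite /direction_block -sum_outer_le sum_outer_split sub0r.
rewrite !(mulmxDl, mulNmx) !mulmx_suml mul1mx e1 e2 !(mulmxDr, mulmxDl).
move: (_ *m hv) (_ *m hv) (_ *m hv) (_ *m hv) (\sum_(_ < k | _) _) => a b c d e.
by apply/matrixP=> x y; rewrite !mxE; ring.
Qed.

End Stationary.

Theorem theorem1 (R : rcfType) (n k : nat)
  (F : 'cV[R]_n -> 'cV[R]_n) (J : 'cV[R]_n -> 'M[R]_n)
  (hF : C2_with_jacobian F J)
  (hk1 : (1 <= k)%N) (hkn : (k <= n)%N)
  (xs : 'cV[R]_n) (vs : 'I_k -> 'cV[R]_n)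
  (hon : forall i j : 'I_k, ((vs j)^T *m vs i) 0 0 = (i == j)%:R)
  (lam : 'I_n -> R)
  (hchar : char_poly (J xs) = \prod_(i < n) ('X - (lam i)%:P))
  (hnz : forall i : 'I_n, lam i != 0)
  (hord : forall i j : 'I_n, (i < j)%N -> lam j <= lam i)
  (hstrict : forall i j : 'I_n, (i < j)%N -> (i < k)%N -> lam j < lam i)
  (w : 'I_k -> 'cV[R]_n)
  (hw : forall j : 'I_k, w j != 0 /\ J xs *m w j = lam (widen_ord hkn j) *: w j) :
  lin_stable_stationary (ghisd_field F J) (ghisd_state xs vs) <->
  (index_saddle F J xs k /\
   forall i : 'I_k, (rows_upto vs i == rows_upto w i)%MS).
Proof.
pose V : 'M[R]_(k, n) := \matrix_(i < k) (vs i)^T.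
have VV : V *m V^T = 1%:M.
  apply/matrixP=> i j; rewrite [RHS]mxE eq_sym -hon !mxE.
  by apply: eq_bigr => l _; rewrite !mxE.
have [dF [H [dH _]]] := hF.
have dJ : mx_deriv J xs (fun h => vec_mx (H xs *m h)^T).
  apply: mx_deriv_ext (mx_deriv_vec_mx (is_deriv_mx_deriv (dH xs))) => // y.
  by rewrite trmxK mxvecK.
(* Orthonormality makes the flag coefficients unique, so the diagonal of [Q] in the linearization is
   that of [L]. *)
have flagE L : V *m (J xs)^T = L *m V -> V *m (J xs)^T *m V^T = L.
  by move=> ->; rewrite -mulmxA VV mulmx1.
split.
  move=> [/(stationary_iff F J xs VV)[F0 [L VJ Lt]] [D dD neg]].
  have [D' [dD' DA DB]] := ghisd_deriv vs (dF xs) dJ F0.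
  (* Stability supplies some derivative matrix; uniqueness identifies it with the computed one. *)
  rewrite (is_deriv_unique dD dD') in neg.
  have [Aneg Bneg] := (ghisd_all_eig_neg DA DB).1 neg.
  rewrite -/V (flagE _ VJ) in Bneg.
  have Ld := stable_flag_diag hkn hchar hord VV VJ Lt Bneg.
  have gap := (position_block_stable hchar VV VJ Lt Ld).1 Aneg.
  split; last exact: (flag_spans hchar hstrict VV VJ Lt Ld hw).
  split=> //; first exact: eigenvalues_nonzero_hyperbolic hchar hnz.
  exact: (gap_has_dim hk1 hchar hstrict VV VJ Lt Ld hw gap).
move=> [[F0 _ dim] spans].
have [L VJ [Lt Ld]] := spans_flag VV hw erefl spans.
have gap := has_dim_gap hk1 hchar hnz hord hstrict VV VJ Lt Ld hw dim.
split; first by apply/(stationary_iff F J xs VV); split=> //; exists L.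
have [D [dD DA DB]] := ghisd_deriv vs (dF xs) dJ F0.
exists D => //; apply/(ghisd_all_eig_neg DA DB); split.
  exact/(position_block_stable hchar VV VJ Lt Ld).
move=> i; rewrite -/V (flagE _ VJ).
exact: (direction_block_stable hchar hstrict VV VJ Lt Ld gap).
Qed.
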